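(* Let $K$ be a number field, $\mathfrak{o}$ its ring of integers and let $d\geq 2$ be an integer. The density of the set $\Gamma^d\subseteq\mathfrak{o}^{d+1}$ of Eisenstein polynomials of degree $d$ over $\mathfrak{o}$ exists, is independent of the integral basis, and is given by $$\rho(\Gamma^d)=1-\prod_{\mathfrak{p}\in\mathcal{P}_K}\left(1-\frac{(N(\mathfrak{p})-1)^2}{N(\mathfrak{p})^{d+2}}\right),$$ where $N(\mathfrak{p})=|\mathfrak{o}/\mathfrak{p}|$.
   Context: $\mathcal{P}_K$ is the set of non-zero prime ideals of $\mathfrak{o}$. A polynomial $a_0+a_1x+\dots+a_dx^d\in\mathfrak{o}[x]$ is identified with the tuple $(a_0,\dots,a_d)\in\mathfrak{o}^{d+1}$. For $\mathfrak{p}\in\mathcal{P}_K$ it is called $\mathfrak{p}$-Eisenstein if $a_d\notin\mathfrak{p}$, $a_i\in\mathfrak{p}$ for all $i\in\{0,\dots,d-1\}$, and $a_0\notin\mathfrak{p}^2$; it is called Eisenstein if it is $\mathfrak{p}$-Eisenstein for some $\mathfrak{p}\in\mathcal{P}_K$. $\Gamma^d$ is the set of all Eisenstein polynomials of degree $d$. Density: let $k=[K:\mathbb{Q}]$. For an integral basis $\mathbb{E}=\{e_1,\dots,e_k\}$ of $\mathfrak{o}$ and a positive integer $H$ put $O(H,\mathbb{E})=\{\sum_{j=1}^k a_je_j : a_j\in[-H,H)\cap\mathbb{Z}\}$. For $T\subseteq\mathfrak{o}^{m}$ put $\rho_\mathbb{E}(T)=\lim_{H\to\infty}\frac{|T\cap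 O(H,\mathbb{E})^{m}|}{(2H)^{mk}}$ if the limit exists; if it exists for every $\mathbb{E}$ and does not depend on $\mathbb{E}$, it is denoted $\rho(T)$. *)

(* Defs.v *)
From HB Require Import structures.
From mathcomp Require Import all_boot all_order all_algebra all_field.
From mathcomp Require Import finmap.
From mathcomp Require Import all_classical all_reals all_analysis.
From mathcomp.analysis.showcase Require Import summability.

Set Implicit Arguments.
Unset Strict Implicit.
Unset Printing Implicit Defensive.

Import Order.TTheory GRing.Theory Num.Theory.
Import numFieldNormedType.Exports.

Local Open Scope classical_set_scope.
Local Open Scope ring_scope.

(* A number field is a finite extension of [rat], i.e. [K : fieldExtType rat];
   its degree over the rationals is [\dim {:K}]. *)

Section RingOfIntegers.
Variable K : fieldExtType rat.

Definition algint : {pred K} :=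
  fun x => `[< integralOver (intr : int -> K) x >].

Fact algint_subring_closed : subring_closed algint.
Proof.
split=> [|x y /asboolP xP /asboolP yP|x y /asboolP xP /asboolP yP]; apply/asboolP.
- exact: integral1.
- exact: integral_sub.
- exact: integral_mul.
Qed.
HB.instance Definition _ :=
  GRing.isSubringClosed.Build K algint algint_subring_closed.

Record ringOfIntegers := RingOfIntegers {
  oval :> K;
  _ : oval \in algint
}.
HB.instance Definition _ := [isSub for oval].
HB.instance Definition _ := [Choice of ringOfIntegers by <:].
HB.instance Definition _ :=
  [SubChoice_isSubComNzRing of ringOfIntegers by <:].

End RingOfIntegers.

Section PrimeIdeals.
Variable K : fieldExtType rat.
Local Notation o := (ringOfIntegers K).

Definition nzPrimeIdeals : set (set o) :=
  [set p : set o | [/\ idealr_closed [in p], prime_idealr_closed [in p]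
             & exists2 x, p x & x != 0]].

(* The type of non-zero prime ideals is [set_type (nzPrimeIdeals K)]. *)
Implicit Type p : set_type nzPrimeIdeals.

Definition in_ideal p : {pred o} := [in \val p].

Fact in_ideal_closed p : idealr_closed (in_ideal p).
Proof. by have [] := set_mem (valP p). Qed.
HB.instance Definition _ p :=
  isIdealr.Build o (in_ideal p) (in_ideal_closed p).

Fact in_ideal_prime p : prime_idealr_closed (in_ideal p).
Proof. by have [] := set_mem (valP p). Qed.
HB.instance Definition _ p :=
  isPrimeIdealrClosed.Build o (in_ideal p) (@in_ideal_prime p).

(* [fset_set] is the empty finite set on infinite sets; here the quotient is
   always finite. *)
Definition idealNorm p : nat := #|` fset_set [set: {ideal_quot (in_ideal p)}]|.

End PrimeIdeals.

Arguments nzPrimeIdeals K _ : clear implicits.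

Definition ideal_square (A : comNzRingType) (I : set A) : set A :=
  [set x | exists n (a b : 'I_n -> A),
     [/\ forall i, I (a i), forall i, I (b i) & x = \sum_(i < n) a i * b i]].

Section Eisenstein.
Variable K : fieldExtType rat.
Local Notation o := (ringOfIntegers K).

Definition eisenstein_at (p : set o) (f : {poly o}) : Prop :=
  [/\ ~ p (lead_coef f),
      forall i, (i < (size f).-1)%N -> p f`_i
    & ~ ideal_square p f`_0].

Definition eisenstein (f : {poly o}) : Prop :=
  exists2 p, nzPrimeIdeals K p & eisenstein_at p f.

(* The tuple [a] is identified with the polynomial [rVpoly a], whose i-th
   coefficient is [a 0 i]; having degree d is having size [d.+1]. *)
Definition eisenstein_tuples (d : nat) : set 'rV[o]_(d.+1) :=
  [set a | size (rVpoly a) = d.+1 /\ eisenstein (rVpoly a)].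

End Eisenstein.

Section Density.
Variables (R : realType) (K : fieldExtType rat).
Local Notation o := (ringOfIntegers K).
Local Notation k := (\dim {:K}).

Definition integral_basis (e : 'I_k -> o) : Prop :=
  forall x : o, exists! c : {ffun 'I_k -> int}, x = \sum_j e j *~ c j.

Definition box (e : 'I_k -> o) (H : nat) : set o :=
  [set x | exists a : 'I_k -> int,
     (forall j, - H%:Z <= a j < H%:Z) /\ x = \sum_j e j *~ a j].

Definition box_count (m : nat) (T : set 'rV[o]_m) (e : 'I_k -> o) (H : nat) :
  nat := #|` fset_set (T `&` [set v | forall i, box e H (v 0 i)])|.

Definition density_wrt (m : nat) (e : 'I_k -> o) (T : set 'rV[o]_m) (r : R) :
  Prop :=
  (box_count T e H)%:R / (2 * H%:R) ^+ (m * k) @[H --> \oo] --> r.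

Definition has_density (m : nat) (T : set 'rV[o]_m) (r : R) : Prop :=
  forall e, integral_basis e -> density_wrt e T r.

End Density.

Section UnorderedProduct.
Variables (R : realType) (I : choiceType).

(* [totally] is the filter of finite subsets of [I] ordered by inclusion. *)
Definition has_prod (f : I -> R) (P : R) : Prop :=
  (fun J : {fset I} => \prod_(i <- J) f i) @ totally --> P.

End UnorderedProduct.

(* Main.v *)
Require Import Defs.
From HB Require Import structures.
From mathcomp Require Import all_boot all_order all_algebra all_field perm.
From mathcomp Require Import finmap.
From mathcomp Require Import all_classical all_reals all_analysis.
From mathcomp Require Import zify ring lra.

(* The unordered product converges because its factors lie in [0, 1].  For a
   finite set J of primes, being p-Eisenstein for no p in J is a condition modulo
   the squares p ^ 2, which are pairwise coprime; by the Chinese remainder theorem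
   its density is the partial product over J, once one knows |p / p ^ 2| = N(p),
   i.e. that non-zero primes of o are invertible.
   The remaining primes contribute little because d >= 2 forces both a_0 and a_1
   into p, with a_0 <> 0.  If p lies over the rational prime l, an element of p in
   a box of side M = 2H has one coordinate determined modulo l by the others, so
   the proportion of such pairs is at most (2 / l) ^ 2 when l <= M, and at most k
   primes lie over each l, which gives a tail of a convergent series.  When l > M,
   l divides the norm of a_0, which is O(M ^ k), so each a_0 leaves at most k + 1
   choices of l, and a_1 then has probability at most 1 / M. *)

Set Implicit Arguments.
Unset Strict Implicit.
Unset Printing Implicit Defensive.

Import Order.TTheory GRing.Theory Num.Theory.
Import numFieldNormedType.Exports.

Local Open Scope classical_set_scope.
Local Open Scope ring_scope.

(** * Ideals and primes *)

(** The factor (N-1)^2 / N^(d+2) is a product over the coefficients: (N-1)/N^2 for a_0 in p but not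
    in p^2, where |p/p^2| = N enters, (N-1)/N for a leading coefficient outside p, and 1/N for each
    of the d-1 others. Density is not countably additive, so the passage from finite J to all primes
    needs an estimate uniform in H. A plain union bound does not give it: once l exceeds M, the
    bound 1/M on the proportion of the box in p no longer decreases with l, and infinitely many l
    remain. Only the non-vanishing of a_0 limits them. Counting takes place in the finite set
    {0,...,n}^k of coordinate vectors modulo n+1, where n+1 lies in all the ideals at hand; ideals
    are predicates on it, and indices of ideals become ratios of counts. The finiteness of o/(n+1)
    also stands in for noetherianity when primes are shown to be maximal and invertible. *)

Section IdealSets.
Variable A : comNzRingType.
Implicit Types (I J : set A) (x y a : A).

(** Unlike [idealr_closed], this includes the whole ring, which arises in the sieve as the
    intersection over an empty list of primes. *)
Record ideal_set I : Prop := IdealSet {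
  ideal_set0 : I 0;
  ideal_setB : forall x y, I x -> I y -> I (x - y);
  ideal_setMl : forall a x, I x -> I (a * x) }.

Lemma ideal_setN I x : ideal_set I -> I x -> I (- x).
Proof. by move=> [I0 IB _] Ix; rewrite -sub0r; apply: IB. Qed.

Lemma ideal_setD I x y : ideal_set I -> I x -> I y -> I (x + y).
Proof.
by move=> iI Ix Iy; rewrite -[y]opprK; apply: ideal_setB => //; apply: ideal_setN.
Qed.

Lemma ideal_setMr I a x : ideal_set I -> I x -> I (x * a).
Proof. by move=> iI Ix; rewrite mulrC; apply: ideal_setMl. Qed.

Lemma ideal_setBC I x y : ideal_set I -> I (x - y) -> I (y - x).
Proof. by move=> iI Ixy; rewrite -opprB; apply: ideal_setN. Qed.

Lemma ideal_set_congr I x y : ideal_set I -> I (x - y) -> I x <-> I y.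
Proof.
move=> iI Ixy; split=> [Ix|Iy].
  by rewrite -(subKr x y); apply: ideal_setB.
by rewrite -(subrK y x); apply: ideal_setD.
Qed.

Lemma ideal_set_sum I (T : Type) (r : seq T) (P : pred T) (F : T -> A) :
  ideal_set I -> (forall i, P i -> I (F i)) -> I (\sum_(i <- r | P i) F i).
Proof.
move=> iI IF; elim/big_ind: _ => //; first exact: ideal_set0.
by move=> x y; apply: ideal_setD.
Qed.

Lemma ideal_squareM I x y : I x -> I y -> ideal_square I (x * y).
Proof.
by move=> Ix Iy; exists 1%N, (fun=> x), (fun=> y); split=> //; rewrite big_ord1.
Qed.

Lemma ideal_square_sub I : ideal_set I -> ideal_square I `<=` I.
Proof.
move=> iI _ [n [a [b [Ia Ib ->]]]]; apply: ideal_set_sum => // i _.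
exact: ideal_setMl.
Qed.

Lemma ideal_square_ideal I : ideal_set I -> ideal_set (ideal_square I).
Proof.
move=> iI; split.
- by exists 0%N, (fun=> 0), (fun=> 0); split=> //; [case|case|rewrite big_ord0].
- move=> _ _ [n [a [b [Ia Ib ->]]]] [m [c [d [Ic Id ->]]]].
  exists (n + m)%N,
    (fun i => match fintype.split i with inl j => a j | inr j => - c j end),
    (fun i => match fintype.split i with inl j => b j | inr j => d j end).
  split.
  + by move=> i; case: fintype.split => j //; apply: ideal_setN.
  + by move=> i; case: fintype.split.
  + rewrite big_split_ord /=; congr (_ + _).
      by apply: eq_bigr => i _; rewrite (unsplitK (inl i)).
    rewrite -sumrN; apply: eq_bigr => i _.
    by rewrite (unsplitK (inr i)) mulNr.
- move=> x _ [n [a [b [Ia Ib ->]]]].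
  exists n, (fun i => x * a i), b; split => //.
    by move=> i; apply: ideal_setMl.
  by rewrite mulr_sumr; apply: eq_bigr => i _; rewrite mulrA.
Qed.

End IdealSets.

Section PrimeIdeals.
Variable K : fieldExtType rat.
Local Notation o := (ringOfIntegers K).
Implicit Types (p q : set o) (x y : o).

Lemma prime_ideal p : nzPrimeIdeals K p -> ideal_set p.
Proof.
case=> [[p0 p1 pL] _ _]; split.
- by move: p0; rewrite inE.
- move=> x y px py; rewrite -[x - y]addrC -mulN1r.
  by have := pL (-1) y x; rewrite !inE; apply.
- move=> a x px; rewrite -[a * x]addr0.
  by have := pL a x 0; rewrite !inE; apply=> //; move: p0; rewrite inE.
Qed.

Lemma prime_ideal1 p : nzPrimeIdeals K p -> ~ p 1.
Proof. by case=> [[_ p1 _] _ _] p1'; move: p1; rewrite mem_set. Qed.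

Lemma prime_idealM p x y : nzPrimeIdeals K p -> p (x * y) -> p x \/ p y.
Proof.
case=> _ pM _ pxy; have := pM x y; rewrite mem_set // => /(_ isT).
by case/orP; rewrite inE; [left|right].
Qed.

Lemma prime_ideal_notM p x y :
  nzPrimeIdeals K p -> ~ p x -> ~ p y -> ~ p (x * y).
Proof. by move=> pp npx npy /(prime_idealM pp) []. Qed.

Lemma prime_idealX p x n : nzPrimeIdeals K p -> p (x ^+ n) -> p x.
Proof.
move=> pp; elim: n => [|n IH]; first by rewrite expr0 => /(prime_ideal1 pp).
by rewrite exprS => /(prime_idealM pp) [].
Qed.

Lemma prime_ideal_notprod p (T : Type) (r : seq T) (P : pred T) (F : T -> o) :
  nzPrimeIdeals K p -> (forall i, P i -> ~ p (F i)) ->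
  ~ p (\prod_(i <- r | P i) F i).
Proof.
move=> pp pF; elim/big_ind: _ => //; first exact: prime_ideal1.
by move=> x y; apply: prime_ideal_notM.
Qed.

Lemma algint_mulf_eq0 x y : x * y = 0 -> x = 0 \/ y = 0.
Proof.
move=> /(congr1 (@oval K)); rewrite [oval _](rmorphM val) [RHS](rmorph0 val).
move=> /eqP; rewrite mulf_eq0 => /orP [] /eqP xy0; [left|right];
  by apply: val_inj; rewrite [RHS](rmorph0 val).
Qed.

Lemma algint_mulfI x : x != 0 -> injective ( *%R x).
Proof.
move=> /eqP x0 y z /eqP; rewrite -subr_eq0 -mulrBr => /eqP /algint_mulf_eq0 [] //.
by move=> /eqP; rewrite subr_eq0 => /eqP.
Qed.

End PrimeIdeals.

(** * Coordinates and norms *)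

Section IntegralBasis.
Variables (K : fieldExtType rat).
Local Notation o := (ringOfIntegers K).
Local Notation k := (\dim {:K}).
Variables (e : 'I_k -> o) (He : integral_basis e).
Implicit Types (x y z : o) (a b : 'I_k -> int).

Definition zlin a : o := \sum_j e j *~ a j.

Definition zcoord x : {ffun 'I_k -> int} := sval (cid (He x)).

Lemma zcoordK x : zlin (zcoord x) = x.
Proof. by rewrite /zcoord; case: cid => c [/= Ec _]; rewrite [RHS]Ec. Qed.

Lemma zlinK a j : zcoord (zlin a) j = a j.
Proof.
rewrite /zcoord; case: cid => c [_ /= cP].
have /cP -> : zlin a = \sum_j e j *~ [ffun j => a j] j.
  by apply: eq_bigr => i _; rewrite ffunE.
by rewrite ffunE.
Qed.

Lemma zlinB a b : zlin (fun j => a j - b j) = zlin a - zlin b.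
Proof.
by rewrite /zlin -sumrN -big_split; apply: eq_bigr => i _; rewrite mulrzBr.
Qed.

Lemma zcoordB x y j : zcoord (x - y) j = zcoord x j - zcoord y j.
Proof. by rewrite -{1}(zcoordK x) -{1}(zcoordK y) -zlinB zlinK. Qed.

Lemma zlinMz n a : zlin (fun j => n * a j) = n%:~R * zlin a.
Proof.
rewrite /zlin mulr_sumr; apply: eq_bigr => i _.
by rewrite mulrzl -mulrzA mulrC.
Qed.

Lemma zcoordMz n x j : zcoord (n%:~R * x) j = n * zcoord x j.
Proof. by rewrite -{1}(zcoordK x) -zlinMz zlinK. Qed.

Lemma zlin_eq0 a : zlin a = 0 -> forall j, a j = 0.
Proof.
move=> a0 j; rewrite -[LHS](zlinK a) a0 -[0 in LHS](mulr0 0%:~R).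
by rewrite zcoordMz mul0r.
Qed.

Definition mulmat x : 'M[int]_k := \matrix_(i, j) zcoord (x * e i) j.

Lemma mulmatE x i : \sum_j (mulmat x i j)%:~R * e j = x * e i.
Proof.
rewrite -[RHS]zcoordK; apply: eq_bigr => j _.
by rewrite mxE mulrzl.
Qed.

(** From M E = x E the adjugate gives det(M) E = x adj(M) E, so det(M) e_j is a multiple of x for
    every j; expanding 1 in the basis transfers this to det(M). *)
Lemma mulmat_dvd x : exists y, (\det (mulmat x))%:~R = y * x.
Proof.
pose M := map_mx (intr : int -> o) (mulmat x).
pose E := \col_i e i.
have ME : M *m E = x *: E.
  by apply/matrixP => i j; rewrite !mxE -mulmatE; apply: eq_bigr => l _; rewrite !mxE.
have dE j : (\det (mulmat x))%:~R * e j = x * (\adj M *m E) j 0.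
  have /(congr1 (fun B => (B *m E) j 0)) := mul_adj_mx M.
  rewrite mul_scalar_mx -mulmxA ME -scalemxAr det_map_mx.
  by rewrite [LHS]mxE [RHS]mxE [E j 0]mxE => <-.
exists (\sum_j ((\adj M *m E) j 0) *~ zcoord 1 j).
rewrite -[LHS]mulr1 -[X in _ * X = _](zcoordK 1) /zlin mulr_sumr mulr_suml.
by apply: eq_bigr => j _; rewrite mulrzAr dE mulrzAl [x * _]mulrC.
Qed.

Lemma mulmat_det_neq0 x : x != 0 -> \det (mulmat x) != 0.
Proof.
move=> x0; apply/det0P => -[v v0 vM].
(* A left kernel vector holds the coordinates of an element that x annihilates. *)
have : zlin (v 0) * x = 0.
  transitivity (zlin ((v *m mulmat x) 0)).
    rewrite /zlin mulr_suml.
    under eq_bigr => i _ do rewrite mulrzAl [e i * x]mulrC -mulmatE -mulrzl mulr_sumr.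
    rewrite exchange_big; apply: eq_bigr => j _.
    rewrite -mulrzl mxE rmorph_sum mulr_suml; apply: eq_bigr => i _.
    by rewrite rmorphM mulrA.
  by rewrite vM /zlin big1 // => j _; rewrite mxE mulr0z.
case/algint_mulf_eq0 => [/zlin_eq0 v0'|x0']; last by rewrite x0' eqxx in x0.
by case/eqP: v0; apply/rowP => j; rewrite v0' mxE.
Qed.

(** The absolute value of the field norm of x. It enters as a positive integer multiple of x whose
    size is controlled by the coordinates. *)
Definition absnorm x : nat := `|\det (mulmat x)|%N.

Lemma absnorm_gt0 x : x != 0 -> (0 < absnorm x)%N.
Proof. by move=> /mulmat_det_neq0; rewrite absz_gt0. Qed.

Lemma absnorm_dvd x : exists y, (absnorm x)%:R = y * x.
Proof.
have [y Ey] := mulmat_dvd x; exists (y *~ Num.sg (\det (mulmat x))).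
rewrite mulrzAl -Ey -mulrzl -rmorphM -[RHS]/(_%:~R) /= -normrEsg.
by rewrite -abszE.
Qed.

(** The entries of the multiplication matrix are linear in the coordinates, hence at most B M, where
    B sums the absolute values of all structure constants; the Leibniz formula then gives C = k!
    B^k. *)
Lemma absnorm_bound : exists C : nat, forall a (M : nat),
  (forall j, `|a j| <= M%:Z) -> (absnorm (zlin a) <= C * M ^ k)%N.
Proof.
pose B : int := \sum_l \sum_i \sum_j `|zcoord (e l * e i) j|.
have B0 : 0 <= B.
  by do 3![apply: sumr_ge0 => ? _].
exists (k`! * `|B| ^ k)%N => a M aM.
have entry i j : `|mulmat (zlin a) i j| <= B * M%:Z.
  have -> : mulmat (zlin a) i j = \sum_l a l * zcoord (e l * e i) j.
    rewrite mxE -[RHS](zlinK (fun j => \sum_l a l * zcoord (e l * e i) j)).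
    congr (zcoord _ _); rewrite /zlin mulr_suml.
    under [RHS]eq_bigr => h _ do rewrite mulrz_sumr.
    rewrite exchange_big; apply: eq_bigr => l _.
    rewrite mulrzAl -{1}(zcoordK (e l * e i)) /zlin mulrz_suml.
    by apply: eq_bigr => h _; rewrite -mulrzA mulrC.
  rewrite (le_trans (ler_norm_sum _ _ _))// mulr_suml ler_sum// => l _.
  rewrite normrM mulrC ler_pM//.
  rewrite (bigD1 i) //= (bigD1 j) //= -addrA lerDl addr_ge0 //.
    by apply: sumr_ge0.
  by do 2![apply: sumr_ge0 => ? _].
rewrite /absnorm -lez_nat abszE /determinant.
rewrite (le_trans (ler_norm_sum _ _ _))//.
apply: (@le_trans _ _ (\sum_(s : 'S_k) (B * M%:Z) ^+ k)).
  apply: ler_sum => s _; rewrite normrM normrX normrN1 expr1n mul1r.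
  rewrite normr_prod -[k in X in _ <= X]card_ord -prodr_const.
  by apply: ler_prod => i _; rewrite normr_ge0 entry.
rewrite sumr_const card_Sn -[B]gez0_abs// -PoszM -natz -natrX -mulrnA natz.
by rewrite gez0_abs// expnMn mulnC mulnA.
Qed.

End IntegralBasis.

(** * Residues modulo an integer *)

Section Residues.
Variables (K : fieldExtType rat).
Local Notation o := (ringOfIntegers K).
Local Notation k := (\dim {:K}).
Variables (e : 'I_k -> o) (He : integral_basis e).
Implicit Types (x y z : o) (I p : set o).

(** One parametrization for two purposes: [off] = 0 yields representatives of o/M, while M = 2H with
    [off] = H yields the box with coordinates in [-H, H). *)
Definition pt (M off : nat) (f : {ffun 'I_k -> 'I_M}) : o :=
  zlin e (fun j => (f j : nat)%:Z - off%:Z).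

Definition resi (n : nat) x : {ffun 'I_k -> 'I_n.+1} :=
  [ffun j => inord `|(zcoord He x j %% n.+1%:Z)%Z|%N].

Lemma resiE n x j : (resi n x j : nat)%:Z = (zcoord He x j %% n.+1%:Z)%Z.
Proof.
have r0 : 0 <= (zcoord He x j %% n.+1%:Z)%Z by rewrite modz_ge0.
have rn : (zcoord He x j %% n.+1%:Z)%Z < n.+1%:Z by rewrite ltz_pmod.
by rewrite ffunE inordK ?gez0_abs // -ltz_nat gez0_abs.
Qed.

Lemma dvd_zcoordP n x :
  (forall j, (n%:Z %| zcoord He x j)%Z) <-> exists z, x = n%:R * z.
Proof.
split=> [nx|[z ->] j]; last first.
  by rewrite -[n%:R]/(n%:~R) zcoordMz dvdz_mulr.
exists (zlin e (fun j => (zcoord He x j %/ n)%Z)).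
rewrite -[n%:R]/(n%:~R) -zlinMz -{1}(zcoordK He x).
by apply: eq_bigr => j _; rewrite mulrC divzK.
Qed.

Lemma resiP n x y : resi n x = resi n y <-> exists z, x - y = n.+1%:R * z.
Proof.
rewrite -dvd_zcoordP; split=> [xy j|xy].
  by rewrite zcoordB -eqz_mod_dvd -!resiE xy.
apply/ffunP => j; apply/val_inj/eqP; rewrite -eqz_nat !resiE.
by rewrite eqz_mod_dvd -zcoordB.
Qed.

Lemma ptK n f : resi n (pt 0 f) = f.
Proof.
apply/ffunP => j; apply/val_inj/eqP; rewrite -eqz_nat resiE zlinK subr0.
by rewrite modz_small // ltz_nat ltn_ord.
Qed.

Lemma resiK n x : exists z, x - pt 0 (resi n x) = n.+1%:R * z.
Proof. by apply/resiP; rewrite ptK. Qed.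

(** Pigeonhole among the powers of x in the finite ring o/(n+1). The factored form suits prime
    ideals: one containing n+1 but not x contains 1 - x^m. *)
Lemma pow_collision n x :
  exists i m z, (0 < m)%N /\ x ^+ i * (1 - x ^+ m) = n.+1%:R * z.
Proof.
pose T : finType := {ffun 'I_k -> 'I_n.+1}.
pose F (i : 'I_(#|T|.+1)) := resi n (x ^+ i).
have /injectivePn[i [j ij Fij]] : ~~ injectiveb F.
  by apply/negP => /injectiveP /leq_card; rewrite card_ord ltnn.
wlog lij : i j ij Fij / (i < j)%N => [hwlog|].
  have := ij; rewrite neq_ltn => /orP[lij|lji]; first exact: hwlog ij Fij lij.
  by apply: hwlog lji => //; rewrite eq_sym.
have /resiP [z Ez] := Fij; exists i, (j - i)%N, z.
by rewrite subn_gt0 mulrBr mulr1 -exprD subnKC // ltnW.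
Qed.

Lemma prime_ideal_nat p : nzPrimeIdeals K p -> exists n, p n.+1%:R.
Proof.
move=> pp; have [_ _ [x px x0]] := pp.
have [y Ey] := absnorm_dvd He x; exists (absnorm He x).-1.
rewrite prednK ?absnorm_gt0 // Ey.
exact: (ideal_setMl (prime_ideal pp)).
Qed.

(** The witness l is the least positive integer in p: division with remainder describes all integers
    of p, and a proper factorization of l would put a smaller one into the prime ideal p. *)
Lemma prime_ideal_char p : nzPrimeIdeals K p ->
  exists2 l, prime l & forall c : int, p c%:~R <-> (l%:Z %| c)%Z.
Proof.
move=> pp; have ip := prime_ideal pp.
have ex_n : exists n, (0 < n)%N && `[< p n%:R >].
  by have [n pn] := prime_ideal_nat pp; exists n.+1; apply/asboolP.
case: (ex_minnP ex_n) => l /andP[l0 /asboolP pl] lmin.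
have pP (c : int) : p c%:~R <-> (l%:Z %| c)%Z.
  split=> [pc|/dvdzP[d ->]]; last by rewrite rmorphM; apply: (ideal_setMl ip).
  have l0' : l%:Z != 0 by rewrite eqz_nat -lt0n.
  have r0 : 0 <= (c %% l)%Z by rewrite modz_ge0.
  have pr : p (`|(c %% l)%Z|%N)%:R.
    rewrite -[_%:R]/((`|(c %% l)%Z|%N)%:~R) gez0_abs //.
    have -> : (c %% l)%Z = c - (c %/ l)%Z * l by rewrite {2}(divz_eq c l) addrC addKr.
    by rewrite rmorphB rmorphM; apply: (ideal_setB ip) => //; apply: (ideal_setMl ip).
  apply/dvdz_mod0P/eqP; apply: contraT => c_neq0.
  have : (`|(c %% l)%Z| < l)%N by rewrite -ltz_nat gez0_abs // ltz_pmod.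
  by rewrite ltnNge lmin // absz_gt0 c_neq0; apply/asboolP.
exists l => //; apply/primeP; split.
  case: l l0 pl {lmin pP} => [//|[_ /(prime_ideal1 pp)|//]]; by [].
move=> d /dvdnP[c lE]; have := pl; rewrite lE natrM => /(prime_idealM pp) [].
  move=> /(pP c) /[!dvdzE] /= /dvdnP[a cE]; apply/orP; left.
  have /eqP := lE; rewrite cE -mulnA mulnCA -{1}[l]muln1 eqn_pmul2l //.
  by rewrite eq_sym muln_eq1 => /andP[].
move=> /(pP d) ld; apply/orP; right.
have {}ld : (l %| d)%N := ld.
by rewrite -lE eqn_dvd ld andbT lE dvdn_mull.
Qed.

Lemma prime_ideal_maximal p x :
  nzPrimeIdeals K p -> ~ p x -> exists y, p (1 - x * y).
Proof.
move=> pp npx; have [n pn] := prime_ideal_nat pp.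
have [i [m [z [m0 E]]]] := pow_collision n x; exists (x ^+ m.-1).
have /(prime_idealM pp) [/(prime_idealX pp) //|] : p (x ^+ i * (1 - x ^+ m)).
  by rewrite E; apply: ideal_setMr => //; apply: prime_ideal.
by rewrite -exprS prednK.
Qed.

Lemma prime_ideal_sub_eq p q :
  nzPrimeIdeals K p -> nzPrimeIdeals K q -> p `<=` q -> p = q.
Proof.
move=> pp qp pq; apply/seteqP; split=> // x qx; apply: contrapT => npx.
have [y /pq qxy] := prime_ideal_maximal pp npx.
apply: (prime_ideal1 qp); rewrite -(subrK (x * y) 1).
by apply: ideal_setD => //; [|apply: ideal_setMr => //]; apply: prime_ideal.
Qed.

Lemma prime_ideal_separate p q :
  nzPrimeIdeals K p -> nzPrimeIdeals K q -> p <> q -> exists2 x, p x & ~ q x.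
Proof.
move=> pp qp pq; apply: contrapT => H; apply/pq/prime_ideal_sub_eq => // x px.
by apply: contrapT => nqx; apply: H; exists x.
Qed.

(** The element u_i lies in every listed prime except the i-th. Hence the u_i are linearly
    independent in the k-dimensional space o/l over the field with l elements, and counting
    combinations gives l^g <= l^k. *)
Lemma size_primes_over l (s : seq (set o)) : prime l -> uniq s ->
  (forall p, p \in s -> nzPrimeIdeals K p /\ p l%:R) -> (size s <= k)%N.
Proof.
case: l => [//|l] lp us sP; set g := size s.
pose P (i : 'I_g) := nth set0 s i.
have PP i : nzPrimeIdeals K (P i) by case: (sP (P i)) => //; apply: mem_nth.
have Pl i : P i l.+1%:R by case: (sP (P i)) => //; apply: mem_nth.
have sep (i j : 'I_g) : exists x, i != j -> P j x /\ ~ P i x.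
  have [->|ij] := eqVneq i j; first by exists 0.
  have [|x] := @prime_ideal_separate (P j) (P i) (PP _) (PP _).
    by move=> /eqP; rewrite nth_uniq // eq_sym => /eqP/val_inj/eqP; rewrite (negPf ij).
  by exists x.
pose X i j := sval (cid (sep i j)).
have XP i j : i != j -> P j (X i j) /\ ~ P i (X i j) by rewrite /X; case: cid.
pose u i := \prod_(j | j != i) X i j.
have uii i : ~ P i (u i).
  apply: prime_ideal_notprod => // j ji; have [] := XP i j => //.
  by rewrite eq_sym.
have uij i j : i != j -> P i (u j).
  move=> ij; rewrite /u (bigD1 i) //=; apply: ideal_setMr; first exact: prime_ideal.
  by have [] := XP j i; rewrite // eq_sym.
pose F (c : {ffun 'I_g -> 'I_l.+1}) := resi l (\sum_i (c i)%:R * u i).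
have Finj : injective F.
  move=> c d /resiP [z Ez]; apply/ffunP => i.
  have ip := prime_ideal (PP i).
  have : P i (((c i : nat)%:Z - (d i : nat)%:Z)%:~R * u i).
    have -> : ((c i : nat)%:Z - (d i : nat)%:Z)%:~R * u i =
       l.+1%:R * z - \sum_(j | j != i) ((c j)%:R - (d j)%:R) * u j.
      rewrite -Ez -sumrB (bigD1 i) //= -mulrBl.
      under [X in _ = _ + X - _]eq_bigr do rewrite -mulrBl.
      by rewrite addrK rmorphB.
    apply: ideal_setB => //; first exact: ideal_setMr.
    by apply: ideal_set_sum => // j ji; apply: ideal_setMl => //; apply: uij; rewrite eq_sym.
  move=> /(prime_idealM (PP i)) [|/uii//].
  have [l' l'p l'P] := prime_ideal_char (PP i).
  have /eqP El' : l' == l.+1 by rewrite -dvdn_prime2 // -[(_ %| _)%N]/((l'%:Z %| l.+1%:Z)%Z);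
    apply/l'P/Pl.
  move=> /l'P; rewrite El' -eqz_mod_dvd !modz_small ?ltz_nat ?ltn_ord //.
    by rewrite eqz_nat => /eqP/val_inj.
have := leq_card _ Finj; rewrite !card_ffun !card_ord leq_exp2l //.
exact: prime_gt1.
Qed.

End Residues.

(** * Invertibility of primes *)

Lemma in_set_asbool (T : finType) (P : T -> Prop) x :
  reflect (P x) (x \in [set y | `[< P y >]]%SET).
Proof. by rewrite finset.in_set; apply: asboolP. Qed.

Section Invertibility.
Variables (K : fieldExtType rat).
Local Notation o := (ringOfIntegers K).
Local Notation k := (\dim {:K}).
Variables (e : 'I_k -> o) (He : integral_basis e).
Implicit Types (x y z : o) (I p : set o).

(* Cayley-Hamilton: [w] acts on the lattice [I] by an integer matrix. *)
Lemma algint_stable_ideal I (w : K) : ideal_set I ->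
  (exists n, I n.+1%:R) -> (exists2 x, I x & x != 0) ->
  (forall y, I y -> exists2 z, I z & w * oval y = oval z) -> w \in @algint K.
Proof.
move=> iI [n In] [x0 Ix0 x0_neq0] wI; apply/asboolP.
(* A redundant family of generators of I as an abelian group: the multiples (n+1) e_j, and every
   residue representative that lies in I, with 0 in place of the others. *)
pose T : finType := ('I_k + {ffun 'I_k -> 'I_n.+1})%type.
pose g (t : T) : o := match t with
  | inl j => n.+1%:R * e j
  | inr f => if `[< I (pt e 0 f) >] then pt e 0 f else 0 end.
have Ig t : I (g t).
  case: t => [j|f] /=; first exact: ideal_setMr.
  by case: asboolP => // _; apply: ideal_set0.
have gen y : I y -> exists c : T -> int, y = \sum_t g t *~ c t.
  move=> Iy; have [z Ez] := resiK He n y; set f := resi _ _ _ in Ez.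
  exists (fun t => match t with inl j => zcoord He z j | inr f' => (f' == f)%:R end).
  rewrite big_sumType /= (bigD1 f) //= eqxx [X in _ + (_ + X)]big1 ?addr0; last first.
    by move=> f' /negPf ->.
  have -> : `[< I (pt e 0 f) >] = true.
    apply/asboolT/(ideal_set_congr iI _ : I y <-> _) => //.
    by rewrite Ez; apply: ideal_setMr.
  rewrite -(subrK (pt e 0 f) y) Ez -{1}(zcoordK He z) /zlin mulr_sumr.
  by congr (_ + _); apply: eq_bigr => j _; rewrite mulrzAr.
have Hc t : exists c : T -> int, w * oval (g t) = \sum_u oval (g u) *~ c u.
  have [z Iz ->] := wI _ (Ig t); have [c ->] := gen _ Iz; exists c.
  rewrite [LHS](raddf_sum val); apply: eq_bigr => u _.
  by rewrite (raddfMz val).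
pose c t := sval (cid (Hc t)).
have cP t : w * oval (g t) = \sum_u oval (g u) *~ c t u by rewrite /c; case: cid.
pose M : 'M[int]_#|T| := \matrix_(i, j) c (enum_val j) (enum_val i).
exists (char_poly M); first exact: char_poly_monic.
rewrite map_char_poly -eigenvalue_root_char; apply/eigenvalueP.
exists (\row_i oval (g (enum_val i))).
  apply/rowP => j; rewrite !mxE cP (reindex (@enum_val T T)) /=; last exact/onW_bij/enum_val_bij.
  by apply: eq_bigr => i _; rewrite !mxE mulrzr.
(* The eigenvector of generators is non-zero, since x0 is a combination of its entries. *)
apply: contra x0_neq0 => /eqP g0; apply/eqP/val_inj.
have [b ->] := gen _ Ix0; rewrite [LHS](raddf_sum val) big1 ?(rmorph0 val) // => t _.
rewrite (raddfMz val); move/rowP/(_ (enum_rank t)): g0.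
by rewrite !mxE enum_rankK /= => ->; rewrite mul0rz.
Qed.

Definition principal (a : o) : set o := [set x | exists z, x = a * z].

Lemma principal_ideal a : ideal_set (principal a).
Proof.
split; first by exists 0; rewrite mulr0.
- by move=> _ _ [x ->] [y ->]; exists (x - y); rewrite mulrBr.
- by move=> b _ [x ->]; exists (b * x); rewrite mulrCA.
Qed.

(* Choose [c] such that [I : c] is maximal among the colon ideals contained in
   [p].  Then every [q] in [p] satisfies [s q c \in I] for some [s] outside [p]:
   otherwise [I : q c = I : c], and a collision between powers of [q] modulo [n]
   puts [1 - q ^ r] in [p].  As [o / n] is finite, one product of such [s]
   serves all [q] at once. *)
Lemma prime_ideal_associated p I : nzPrimeIdeals K p -> ideal_set I -> I `<=` p ->
  (exists n, I n.+1%:R) ->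
  exists2 c, ~ I c & forall y, p y -> I (c * y).
Proof.
move=> pp iI Ip [n In].
pose good c := forall x, I (c * x) -> p x.
pose cnt c := #|[set f : {ffun 'I_k -> 'I_n.+1} | `[< I (c * pt e 0 f) >]]%SET|.
pose P m := `[< exists2 c, good c & cnt c = m >].
have exP : exists m, P m.
  by exists (cnt 1); apply/asboolP; exists 1 => // x; rewrite mul1r => /Ip.
have bP m : P m -> (m <= #|{: {ffun 'I_k -> 'I_n.+1}}|)%N.
  by move=> /asboolP[c _ <-]; apply: max_card.
case: (ex_maxnP exP bP) => m /asboolP[c gc cm] mmax.
have Irep b x : I (b * x) <-> I (b * pt e 0 (resi He n x)).
  apply: (ideal_set_congr iI); rewrite -mulrBr.
  have [z ->] := resiK He n x.
  by rewrite mulrCA; apply: ideal_setMr.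
have eqc q : good (c * q) -> forall x, I (c * q * x) -> I (c * x).
  move=> gq x; have sub : [set f : {ffun 'I_k -> 'I_n.+1} | `[< I (c * pt e 0 f) >]]%SET \subset
    [set f | `[< I (c * q * pt e 0 f) >]]%SET.
    apply/fintype.subsetP => f /in_set_asbool Ic; apply/in_set_asbool.
    by rewrite mulrAC; apply: ideal_setMr.
  have le : (cnt (c * q)%R <= cnt c)%N by rewrite cm; apply: mmax; apply/asboolP; exists (c * q).
  move: sub; rewrite finset.subEproper => /orP[/eqP E|/proper_card]; last first.
    by rewrite ltnNge le.
  move=> /Irep /(in_set_asbool (fun f => I (c * q * pt e 0 f))).
  by rewrite -E => /(in_set_asbool (fun f => I (c * pt e 0 f))) Ix; apply/Irep.
have eqX q i x : good (c * q) -> I (c * q ^+ i * x) -> I (c * x).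
  move=> gq; elim: i x => [|i IH] x; first by rewrite expr0 mulr1.
  by rewrite exprS mulrA -mulrA => /(eqc _ gq); rewrite mulrA => /IH.
have killq q : p q -> exists2 s, I (c * q * s) & ~ p s.
  move=> pq; apply: contrapT => H.
  have gq : good (c * q).
    by move=> x Ix; apply: contrapT => npx; apply: H; exists x.
  have [i [r [z [r0 E]]]] := pow_collision He n q.
  have /gc pqr : I (c * (1 - q ^+ r)).
    by apply: (eqX q i) => //; rewrite -mulrA E mulrCA; apply: ideal_setMr.
  apply: (prime_ideal1 pp); rewrite -(subrK (q ^+ r) 1).
  apply: ideal_setD => //; first exact: prime_ideal.
  by rewrite -(prednK r0) exprS; apply: ideal_setMr => //; apply: prime_ideal.
have Hs (f : {ffun 'I_k -> 'I_n.+1}) :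
    exists s, ~ p s /\ (p (pt e 0 f) -> I (c * pt e 0 f * s)).
  have [/killq[s Is nps]|npf] := pselect (p (pt e 0 f)); first by exists s.
  by exists 1; split=> //; apply: prime_ideal1.
pose s f := sval (cid (Hs f)).
have sP f : ~ p (s f) /\ (p (pt e 0 f) -> I (c * pt e 0 f * s f)).
  by rewrite /s; case: cid.
exists (c * \prod_f s f).
  by move=> /gc; apply: prime_ideal_notprod => // f _; have [] := sP f.
move=> y py; apply/Irep; set f := resi _ _ _.
have pf : p (pt e 0 f).
  have [z Ez] := resiK He n y.
  apply/(ideal_set_congr (prime_ideal pp) _ : p y <-> _) => //; rewrite Ez.
  by apply: ideal_setMr; [apply: prime_ideal|apply: Ip].
rewrite mulrAC (bigD1 f) //= mulrA; apply: ideal_setMr => //.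
by have [_] := sP f; apply.
Qed.

(** This says that p becomes principal, generated by a, after localization at p. With c p inside
    (a0) and c outside it, w = c/a0 satisfies w p in o but is not in o. As o is integrally closed, w
    p is not contained in p; any y in p with w y outside p provides a = y and s = w y, because s x =
    y (w x). *)
Lemma prime_ideal_invertible p : nzPrimeIdeals K p ->
  exists a s, [/\ p a, ~ p s & forall y, p y -> exists z, s * y = a * z].
Proof.
move=> pp; have ip := prime_ideal pp.
have [_ _ [a0 pa0 a0_neq0]] := pp.
have a0I := @algint_mulfI _ _ a0_neq0.
have [||c nc cP] := @prime_ideal_associated p (principal a0) pp (principal_ideal a0).
- by move=> _ [z ->]; apply: ideal_setMr.
- have [y Ey] := absnorm_dvd He a0; exists (absnorm He a0).-1.
  by rewrite prednK ?absnorm_gt0 // Ey; exists y; rewrite mulrC.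
apply: contrapT => H; apply: nc.
have a0K : oval a0 != 0 by apply: contra a0_neq0 => /eqP a00; apply/eqP/val_inj.
have wo : oval c / oval a0 \in @algint K.
  apply: (@algint_stable_ideal p) => //; first exact: prime_ideal_nat.
    by exists a0.
  move=> y py; have [z Ez] := cP _ py; exists z.
    apply: contrapT => npz; apply: H; exists y, z; split=> // x px.
    have [t Et] := cP _ px; exists t; apply: a0I.
    by rewrite mulrA -Ez mulrAC Et; rewrite mulrAC -mulrA [y * t]mulrC.
  apply: (mulfI a0K); rewrite mulrA mulrCA mulfV // mulr1.
  by have /(congr1 (@oval K)) := Ez; rewrite [LHS](rmorphM val) [RHS](rmorphM val).
exists (RingOfIntegers wo); apply: val_inj.
by rewrite [RHS](rmorphM val) /= mulrCA mulfV // mulr1.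
Qed.

(* [x -> a x] induces an isomorphism from [o / p] onto [p / p ^ 2]. *)
Lemma prime_ideal_uniformizer p : nzPrimeIdeals K p ->
  exists a, [/\ p a, forall x, ideal_square p (a * x) -> p x
                & forall y, p y -> exists x, ideal_square p (y - a * x)].
Proof.
move=> pp; have ip := prime_ideal pp.
have [a [s [pa nps sP]]] := prime_ideal_invertible pp; exists a; split=> //.
- have a0 : a != 0.
    apply/eqP => a0; have [_ _ [y py y0]] := pp; have [z] := sP y py.
    rewrite a0 mul0r => /algint_mulf_eq0 [s0|y0']; last by rewrite y0' eqxx in y0.
    by apply: nps; rewrite s0; apply: ideal_set0.
  move=> x [n [u [v [pu pv E]]]].
  (* Multiplying a x = sum u_i v_i by s turns each s u_i into a z_i, and a cancels. *)
  have : p (s * x); last by move=> /(prime_idealM pp) [].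
  pose z i := sval (cid (sP _ (pu i))).
  have zP i : s * u i = a * z i by rewrite /z; case: cid.
  suff -> : s * x = \sum_i z i * v i.
    by apply: ideal_set_sum => // i _; apply: ideal_setMl.
  apply: (algint_mulfI a0); rewrite mulrCA E !mulr_sumr.
  by apply: eq_bigr => i _; rewrite !mulrA zP.
(* With t inverse to s modulo p, the error y - a z t = (1 - s t) y is a product of two elements of
   p. *)
- move=> y py; have [t pt] := prime_ideal_maximal He pp nps.
  have [z Ez] := sP y py; exists (z * t).
  have -> : y - a * (z * t) = (1 - s * t) * y.
    by rewrite mulrA -Ez mulrBl mul1r mulrAC.
  exact: ideal_squareM.
Qed.

End Invertibility.

(** * Counting residue classes *)

Section Counting.
Local Open Scope quotient_scope.
Variables (K : fieldExtType rat).
Local Notation o := (ringOfIntegers K).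
Local Notation k := (\dim {:K}).
Variables (e : 'I_k -> o) (He : integral_basis e).
Implicit Types (x y z : o) (I J p B : set o) (n m : nat).

Definition reps n B : {set {ffun 'I_k -> 'I_n.+1}} :=
  [set f | `[< B (pt e 0 f) >]]%SET.

Definition cnt n B : nat := #|reps n B|.

Lemma in_reps n B f : reflect (B (pt e 0 f)) (f \in reps n B).
Proof. exact: in_set_asbool. Qed.

Lemma cnt_setT n : cnt n setT = (n.+1 ^ k)%N.
Proof.
rewrite /cnt -[RHS](_ : #|{: {ffun 'I_k -> 'I_n.+1}}| = _).
  by apply: eq_card => f; rewrite [LHS]finset.in_set; apply/asboolP.
by rewrite card_ffun !card_ord.
Qed.

Lemma cntC n B : (cnt n B + cnt n (~` B) = n.+1 ^ k)%N.
Proof.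
rewrite -[RHS](_ : #|{: {ffun 'I_k -> 'I_n.+1}}| = _); last first.
  by rewrite card_ffun !card_ord.
rewrite -(cardsC (reps n B)).
congr (_ + _)%N; apply: eq_card => f.
by rewrite finset.in_setC !finset.in_set -asbool_neg.
Qed.

Lemma cntD n B I : I `<=` B -> (cnt n I + cnt n (B `\` I) = cnt n B)%N.
Proof.
move=> IB; rewrite -[RHS](finset.cardsID (reps n I)).
congr (_ + _)%N; apply: eq_card => f; rewrite ?finset.in_setD ?finset.in_setI !finset.in_set.
  by rewrite -asbool_and; apply/asbool_equiv_eq; split=> [If|[]//]; split=> //; apply: IB.
rewrite -asbool_neg -asbool_and; apply/asbool_equiv_eq.
by rewrite /setD /=; split=> -[].
Qed.

Lemma resi_congr n I x : ideal_set I -> I n.+1%:R -> I (x - pt e 0 (resi He n x)).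
Proof. by move=> iI In; have [z ->] := resiK He n x; apply: ideal_setMr. Qed.

(** B is the disjoint union of the cosets t q + I. As n+1 lies in I, each coset consists of whole
    classes modulo n+1, and translation by t q matches them with the classes in I. *)
Lemma cnt_cosets n I B (Q : finType) (t : Q -> o) :
  ideal_set I -> I n.+1%:R ->
  (forall q x, I (x - t q) -> B x) ->
  (forall x, B x -> exists q, I (x - t q)) ->
  (forall q r, I (t q - t r) -> q = r) ->
  cnt n B = (#|Q| * cnt n I)%N.
Proof.
move=> iI In tB Bt tinj.
pose F (u : Q * {ffun 'I_k -> 'I_n.+1}) := resi He n (t u.1 + pt e 0 u.2).
set D := reps n I.
have <- : #|finset.setX [set: Q]%SET D| = (#|Q| * cnt n I)%N.
  by rewrite finset.cardsX finset.cardsT.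
rewrite -(card_in_imset (f := F)); last first.
  move=> [q f] [r g]; rewrite !finset.in_setX /= => /andP[_ /in_reps If] /andP[_ /in_reps Ig].
  move=> /resiP [z E].
  have /tinj qr : I (t q - t r).
    have -> : t q - t r = n.+1%:R * z - (pt e 0 f - pt e 0 g) by rewrite -E /=; ring.
    by apply: ideal_setB => //; [apply: ideal_setMr|apply: ideal_setB].
  subst r; congr (_, _); rewrite -[LHS](ptK He) -[RHS](ptK He).
  by apply/resiP; exists z; rewrite -E /=; ring.
apply: eq_card => f; apply/in_reps/finset.imsetP => [Bf|[[q g]]].
  have [q Iq] := Bt _ Bf; exists (q, resi He n (pt e 0 f - t q)).
    rewrite finset.in_setX finset.in_setT /=; apply/in_reps.
    exact: (proj1 (ideal_set_congr iI (resi_congr _ iI In)) Iq).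
  rewrite /F /= -[LHS](ptK He); apply/resiP.
  have [z Ez] := resiK He n (pt e 0 f - t q); exists z; rewrite -Ez; ring.
rewrite finset.in_setX /= => /andP[_ /in_reps Ig] ->; apply: (tB q).
rewrite /F /=; set x := t q + _.
rewrite -(subrK x (pt e 0 _)) -addrA; apply: ideal_setD => //.
  by apply: ideal_setBC => //; apply: resi_congr.
by rewrite /x addrC addKr.
Qed.

(** Since [fset_set] is empty on infinite sets, [idealNorm] can be read as the cardinality of the
    quotient only once this is known. *)
Lemma prime_quotient_finite (p : set_type (nzPrimeIdeals K)) :
  finite_set [set: {ideal_quot (in_ideal p)}].
Proof.
have pp : nzPrimeIdeals K (\val p) := set_mem (valP p).
have [n pn] := prime_ideal_nat He pp.
have -> : [set: {ideal_quot (in_ideal p)}] =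
    (fun f : {ffun 'I_k -> 'I_n.+1} => \pi_{ideal_quot (in_ideal p)} (pt e 0 f)) @` setT.
  apply/seteqP; split=> // q _; exists (resi He n (repr q)) => //.
  rewrite -[RHS]reprK; apply/eqP; rewrite eq_sym.
  rewrite -Quotient.idealrBE; apply/mem_set.
  exact: (resi_congr _ (prime_ideal pp)).
by apply: finite_image; apply: finite_finset.
Qed.

Lemma cnt_prime (p : set_type (nzPrimeIdeals K)) n : \val p n.+1%:R ->
  (n.+1 ^ k = idealNorm p * cnt n (\val p))%N.
Proof.
move=> pn; have pp : nzPrimeIdeals K (\val p) := set_mem (valP p).
have fin := prime_quotient_finite p.
pose Q : finType := fset_set [set: {ideal_quot (in_ideal p)}].
rewrite -cnt_setT /idealNorm cardfE.
apply: (@cnt_cosets _ _ _ Q (fun q => repr (val q))) => //; first exact: prime_ideal.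
  move=> x _.
  have inS : \pi_{ideal_quot (in_ideal p)} x \in fset_set [set: {ideal_quot (in_ideal p)}].
    by rewrite in_fset_set // mem_set.
  exists [` inS]%fset => /=; apply/set_mem.
  by have := Quotient.idealrBE (in_ideal p) x (repr (\pi_{ideal_quot (in_ideal p)} x));
    rewrite reprK eqxx.
move=> q r pqr; apply: val_inj; rewrite -[LHS]reprK -[RHS]reprK; apply/eqP.
by rewrite -Quotient.idealrBE; apply/mem_set.
Qed.

Lemma cnt_prime_square (p : set_type (nzPrimeIdeals K)) n :
  ideal_square (\val p) n.+1%:R ->
  (cnt n (\val p) = idealNorm p * cnt n (ideal_square (\val p)))%N.
Proof.
move=> pn; have pp : nzPrimeIdeals K (\val p) := set_mem (valP p).
have ip := prime_ideal pp; have ip2 := ideal_square_ideal ip.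
have fin := prime_quotient_finite p.
have [a [pa ainj asurj]] := prime_ideal_uniformizer He pp.
pose Q : finType := fset_set [set: {ideal_quot (in_ideal p)}].
rewrite /idealNorm cardfE.
apply: (@cnt_cosets _ _ _ Q (fun q => a * repr (val q))) => //.
- move=> q x /(ideal_square_sub ip) px; rewrite -(subrK (a * repr (val q)) x).
  by apply: ideal_setD => //; apply: ideal_setMr.
- move=> x /asurj [y xy].
  have inS : \pi_{ideal_quot (in_ideal p)} y \in fset_set [set: {ideal_quot (in_ideal p)}].
    by rewrite in_fset_set // mem_set.
  exists [` inS]%fset => /=; rewrite -[x](subrK (a * y)) -addrA -mulrBr.
  apply: ideal_setD => //; apply: ideal_squareM => //; apply/set_mem.
  by have := Quotient.idealrBE (in_ideal p) y (repr (\pi_{ideal_quot (in_ideal p)} y));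
    rewrite reprK eqxx.
- move=> q r; rewrite -mulrBr => /ainj pqr; apply: val_inj.
  rewrite -[LHS]reprK -[RHS]reprK; apply/eqP.
  by rewrite -Quotient.idealrBE; apply/mem_set.
Qed.

End Counting.

(** * Sets of tuples defined by congruences *)

Section EisensteinAt.
Variables (K : fieldExtType rat) (d : nat).
Local Notation o := (ringOfIntegers K).

Definition eisenstein_tuples_at (p : set o) : set 'rV[o]_d.+1 :=
  [set v | [/\ ~ p (v 0 ord_max),
               forall i : 'I_d.+1, (i < d)%N -> p (v 0 i)
             & ~ ideal_square p (v 0 0)]].

(** A last entry outside p is non-zero, so the polynomial has degree d and that entry is its leading
    coefficient. *)
Lemma eisenstein_tuplesE : eisenstein_tuples (d := d) =
  [set v | exists2 p, nzPrimeIdeals K p & eisenstein_tuples_at p v].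
Proof.
apply/seteqP; split=> v.
  move=> [sv [p pp [lead low sq]]]; exists p => //.
  have vE (i : 'I_d.+1) : v 0 i = (rVpoly v)`_i by rewrite coef_rVpoly_ord.
  split=> [|i id|]; rewrite vE //; last by apply: low; rewrite sv.
  by move: lead; rewrite /lead_coef sv.
move=> [p pp [lead low sq]].
have sv : size (rVpoly v) = d.+1.
  apply/eqP; rewrite eqn_leq size_poly /= ltnNge; apply/negP => /leq_sizeP /(_ d (leqnn d)).
  rewrite -[d]/(nat_of_ord (@ord_max d)) coef_rVpoly_ord => vd.
  by apply: lead; rewrite vd; apply: (ideal_set0 (prime_ideal pp)).
split=> //; exists p => //; rewrite /eisenstein_at /lead_coef sv /=.
split=> [|i id|].
- by rewrite -[d]/(nat_of_ord (@ord_max d)) coef_rVpoly_ord.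
- by rewrite -[i]/(nat_of_ord (Ordinal (ltnW id : (i < d.+1)%N))) coef_rVpoly_ord; apply: low.
- by rewrite -[0%N]/(nat_of_ord (@ord0 d)) coef_rVpoly_ord.
Qed.

Definition vcongr m (I : set o) (v w : 'rV[o]_m) := forall i, I (v 0 i - w 0 i).

Definition congr_closed m (I : set o) (S : set 'rV[o]_m) :=
  forall v w, vcongr I v w -> S v -> S w.

Lemma congr_closedP m I (S : set 'rV[o]_m) v w : ideal_set I -> congr_closed I S ->
  vcongr I v w -> S v <-> S w.
Proof.
move=> iI pS vw; split; apply: pS => // i.
by rewrite -opprB; apply: ideal_setN.
Qed.

Lemma congr_closedC m (I : set o) (S : set 'rV[o]_m) :
  ideal_set I -> congr_closed I S -> congr_closed I (~` S).
Proof. by move=> iI pS v w vw nSv Sw; apply: nSv; apply/(congr_closedP iI pS vw). Qed.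

Lemma eisenstein_tuples_at_congr_closed p : ideal_set p ->
  congr_closed (ideal_square p) (eisenstein_tuples_at p).
Proof.
move=> ip v w vw [lead low sq]; have ip2 := ideal_square_ideal ip.
have pvw i : p (v 0 i) <-> p (w 0 i).
  by apply: (ideal_set_congr ip); apply: ideal_square_sub.
split; first by move=> /pvw.
  by move=> i /low /pvw.
by move=> /(ideal_set_congr ip2 (vw _)).
Qed.

End EisensteinAt.

Arguments eisenstein_tuples_at {K} d p.

(** * Independence of conditions modulo coprime ideals *)

Section VectorCounting.
Variables (K : fieldExtType rat).
Local Notation o := (ringOfIntegers K).
Local Notation k := (\dim {:K}).
Variables (e : 'I_k -> o) (He : integral_basis e).
Implicit Types (x y z : o) (I J p B : set o) (n m M : nat).

Definition vpt m M off (f : {ffun 'I_m -> {ffun 'I_k -> 'I_M}}) : 'rV[o]_m :=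
  \row_i pt e off (f i).

Definition boxset m M off (S : set 'rV[o]_m) :
    {set {ffun 'I_m -> {ffun 'I_k -> 'I_M}}} :=
  [set f | `[< S (vpt off f) >]]%SET.

Lemma in_boxset m M off (S : set 'rV[o]_m) f :
  reflect (S (vpt off f)) (f \in boxset M off S).
Proof. exact: in_set_asbool. Qed.

Definition vcnt m n (S : set 'rV[o]_m) : nat := #|boxset n.+1 0 S|.

Definition vresi m n (v : 'rV[o]_m) : {ffun 'I_m -> {ffun 'I_k -> 'I_n.+1}} :=
  [ffun i => resi He n (v 0 i)].

Lemma vresiP m n (v w : 'rV[o]_m) :
  vresi n v = vresi n w <-> vcongr (principal n.+1%:R) v w.
Proof.
split=> [vw i|vw].
  by apply/(resiP He); move/ffunP/(_ i): vw; rewrite !ffunE.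
by apply/ffunP => i; rewrite !ffunE; apply/resiP/vw.
Qed.

Lemma vptK m n (f : {ffun 'I_m -> _}) : vresi n (vpt 0 f) = f.
Proof. by apply/ffunP => i; rewrite ffunE mxE ptK. Qed.

Lemma vresi_congr m n (v : 'rV[o]_m) I :
  ideal_set I -> I n.+1%:R -> vcongr I v (vpt 0 (vresi n v)).
Proof. by move=> iI In i; rewrite mxE ffunE; apply: resi_congr. Qed.

Lemma card_boxset_all m M : #|{: {ffun 'I_m -> {ffun 'I_k -> 'I_M}}}| = ((M ^ k) ^ m)%N.
Proof. by rewrite !card_ffun !card_ord. Qed.

Lemma boxsetC m M off (S : set 'rV[o]_m) :
  boxset M off (~` S) = (~: boxset M off S)%SET.
Proof. by apply/setP => f; rewrite finset.in_setC !finset.in_set -asbool_neg. Qed.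

Lemma vcntC m n (S : set 'rV[o]_m) : (vcnt n S + vcnt n (~` S) = (n.+1 ^ k) ^ m)%N.
Proof. by rewrite /vcnt boxsetC cardsC card_boxset_all. Qed.

Lemma vptE m M off c (f g : {ffun 'I_m -> {ffun 'I_k -> 'I_M}}) i :
  (vpt off f + c *: vpt off g) 0 i = pt e off (f i) + c * pt e off (g i).
Proof. by rewrite !mxE. Qed.

(* With [u + w = 1], [u] in [I] and [w] in [J], the unimodular substitution
   [(z, h) -> (z - u h, z + w h)] carries [(S & T) * setT] onto [S * T]. *)
Lemma vcnt_coprime m n (S T : set 'rV[o]_m) I J u w :
  ideal_set I -> ideal_set J -> I n.+1%:R -> J n.+1%:R ->
  I u -> J w -> u + w = 1 -> congr_closed I S -> congr_closed J T ->
  (vcnt n S * vcnt n T = vcnt n (S `&` T) * (n.+1 ^ k) ^ m)%N.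
Proof.
move=> iI iJ In Jn Iu Jw uw pS pT.
pose G : finType := {ffun 'I_m -> {ffun 'I_k -> 'I_n.+1}}.
pose comb c (a : G * G) : G := vresi n (vpt 0 a.1 + c *: vpt 0 a.2).
pose psi (a : G * G) := (comb (- u) a, comb w a).
have combP c a b : comb c a = comb c b -> forall i, principal n.+1%:R
    (pt e 0 (a.1 i) + c * pt e 0 (a.2 i) - (pt e 0 (b.1 i) + c * pt e 0 (b.2 i))).
  by move=> /vresiP E i; have := E i; rewrite !vptE.
have psi_inj : injective psi.
  move=> a b E.
  have E1 := combP _ _ _ (congr1 fst E); have E2 := combP _ _ _ (congr1 snd E).
  (* Subtracting the first component from the second leaves (u + w) h = h; then z is recovered from
     the first. *)
  have Eh i : principal n.+1%:R (pt e 0 (a.2 i) - pt e 0 (b.2 i)).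
    have [x Ex] := E1 i; have [y Ey] := E2 i; exists (y - x).
    rewrite mulrBr -Ex -Ey -[LHS]mul1r -uw.
    move: (pt _ _ _) (pt _ _ _) (pt _ _ _) (pt _ _ _) => *; ring.
  have Ez i : principal n.+1%:R (pt e 0 (a.1 i) - pt e 0 (b.1 i)).
    have [x Ex] := E1 i; have [y Ey] := Eh i; exists (x + u * y).
    rewrite mulrDr mulrCA -Ex -Ey.
    move: (pt _ _ _) (pt _ _ _) (pt _ _ _) (pt _ _ _) => *; ring.
  by rewrite [a]surjective_pairing [b]surjective_pairing; congr (_, _);
    rewrite -[LHS]vptK -[RHS]vptK; apply/vresiP => i; rewrite !mxE.
rewrite -card_boxset_all -[#|_|]finset.cardsT -!finset.cardsX.
have <- := card_preimset (finset.setX (boxset n.+1 0 S) (boxset n.+1 0 T)) psi_inj.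
apply: eq_card => -[z h]; rewrite finset.in_set !finset.in_setX finset.in_setT andbT.
have combE (X : set o) c : ideal_set X -> X n.+1%:R -> X c ->
    vcongr X (vpt 0 z) (vpt 0 (comb c (z, h))).
  move=> iX Xn Xc i.
  have := @vresi_congr m n (vpt 0 z + c *: vpt 0 h) X iX Xn i.
  move/(ideal_setB iX)/(_ (ideal_setMr (pt e 0 (h i)) iX Xc)).
  by rewrite vptE [vpt 0 z 0 i]mxE addrAC addrK.
have SE := congr_closedP iI pS (combE _ _ iI In (ideal_setN iI Iu)).
have TE := congr_closedP iJ pT (combE _ _ iJ Jn Jw).
apply/andP/in_boxset => [[/in_boxset/SE Sz /in_boxset/TE Tz] //|[Sz Tz]].
by split; apply/in_boxset; [apply/SE|apply/TE].
Qed.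

Lemma vcnt_prod m n (F : 'I_m -> set o) :
  vcnt n [set v | forall i, F i (v 0 i)] = (\prod_i cnt e n (F i))%N.
Proof.
transitivity #|family (fun i => mem (reps e n (F i)))|; last first.
  by rewrite card_family foldrE big_map big_enum.
apply: eq_card => f; apply/in_boxset/familyP => [Ff i|Ff i /=].
  by have := Ff i; rewrite mxE => ?; apply/in_reps.
by rewrite mxE; apply/in_reps/Ff.
Qed.

Lemma prime_square_coprime p q : nzPrimeIdeals K p -> nzPrimeIdeals K q -> p <> q ->
  exists2 u, ideal_square p u & ideal_square q (1 - u).
Proof.
move=> pp qp pq; have [x px nqx] := prime_ideal_separate He pp qp pq.
have [y qxy] := prime_ideal_maximal He qp nqx; set a := x * y; set b := 1 - a.
have pa : p a by apply: ideal_setMr => //; apply: prime_ideal.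
(* The expansion of 1 = (a + b)^3 splits into a^2 (a + 3b), in the square of p, and b^2 (b + 3a), in
   the square of q. *)
exists (a * a * (a + 3 * b)).
  apply: ideal_setMr; first exact/ideal_square_ideal/prime_ideal.
  exact: ideal_squareM.
have -> : 1 - a * a * (a + 3 * b) = b * b * (b + 3 * a) by rewrite /b; ring.
apply: ideal_setMr; first exact/ideal_square_ideal/prime_ideal.
exact: ideal_squareM.
Qed.

End VectorCounting.

(** * Local densities and the sieve over finitely many primes *)

Section EisensteinCounts.
Variables (R : realType) (K : fieldExtType rat).
Local Notation o := (ringOfIntegers K).
Local Notation k := (\dim {:K}).
Variables (e : 'I_k -> o) (He : integral_basis e).
Implicit Types (p : set_type (nzPrimeIdeals K)) (n d : nat).

Definition eisenstein_density d p : R :=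
  ((idealNorm p)%:R - 1) ^+ 2 / (idealNorm p)%:R ^+ (d + 2).

Lemma val_prime p : nzPrimeIdeals K (\val p).
Proof. exact: set_mem (valP p). Qed.

Lemma prime_square_ideal p : ideal_set (ideal_square (\val p)).
Proof. exact: ideal_square_ideal (prime_ideal (val_prime p)). Qed.

Lemma vcnt_eisenstein p d n : (1 <= d)%N -> ideal_square (\val p) n.+1%:R ->
  (vcnt e n (eisenstein_tuples_at d (\val p)))%:R
    = ((n.+1 ^ k) ^ d.+1)%:R * eisenstein_density d p.
Proof.
case: d => // d _ pn; have ip := prime_ideal (val_prime p).
have sqp := ideal_square_sub ip.
(* For degree at least 1 the first and last entries are distinct, so the conditions constrain each
   entry separately and the count is a product. *)
pose F (i : 'I_d.+2) : set o :=
  if i == ord0 then \val p `\` ideal_square (\val p)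
  else if i == ord_max then ~` (\val p) else \val p.
have -> : eisenstein_tuples_at d.+1 (\val p) = [set v | forall i, F i (v 0 i)].
  apply/seteqP; split=> v.
    move=> [lead low sq] i; rewrite /F; case: eqP => [->|_].
      by split=> //; apply: low.
    case: eqP => [->//|/eqP im]; apply: low.
    by rewrite ltn_neqAle -ltnS ltn_ord andbT.
  move=> Fv; split.
  - by have := Fv ord_max; rewrite /F eqxx.
  - move=> i id; have := Fv i; rewrite /F; case: eqP => [_ []//|_].
    by case: eqP => // im; move: id; rewrite im ltnn.
  - by have := Fv ord0; rewrite /F eqxx => -[].
rewrite vcnt_prod big_ord_recl big_ord_recr /=.
rewrite (eq_bigr (fun=> cnt e n (\val p))); last first.
  move=> i _; rewrite /F -[lift _ _ == ord_max]val_eqE /= /bump /= add1n eqSS.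
  by rewrite ltn_eqF.
rewrite big_const_ord iter_muln muln1 /F eqxx -[lift _ _ == ord_max]val_eqE /= eqxx.
have E1 := cnt_prime He (sqp _ pn); have E2 := cnt_prime_square He pn.
have ED := cntD e n sqp; have EC := cntC e n (\val p).
have a0 : (n.+1 ^ k)%:R != 0 :> R by rewrite pnatr_eq0 -lt0n expn_gt0.
rewrite natrX !natrM natrX.
have {}ED : (cnt e n (\val p `\` ideal_square (\val p)))%:R =
  (cnt e n (\val p))%:R - (cnt e n (ideal_square (\val p)))%:R :> R.
  by rewrite -ED natrD addrC addKr.
have {}EC : (cnt e n (~` (\val p)))%:R =
  (n.+1 ^ k)%:R - (cnt e n (\val p))%:R :> R.
  by rewrite -EC natrD addrC addKr.
rewrite ED EC /eisenstein_density; move: a0; rewrite E1 E2 !natrM.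
set N : R := (idealNorm p)%:R; set c := (cnt e n _)%:R.
rewrite !mulf_eq0 !negb_or => /andP[N0 _].
rewrite !exprMn (_ : d.+1 + 2 = d.+3)%N; last by rewrite addn2.
rewrite !exprS.
have Nd : N ^+ d != 0 by rewrite expf_neq0.
by field; rewrite N0 Nd.
Qed.

Lemma exists_square_multiple (s : seq (set_type (nzPrimeIdeals K))) :
  exists n, forall p, p \in s -> ideal_square (\val p) n.+1%:R.
Proof.
elim: s => [|q s [n Hn]]; first by exists 0%N.
have [m qm] := prime_ideal_nat He (val_prime q).
exists (m.+1 * m.+1 * n.+1).-1 => p; rewrite prednK ?muln_gt0 // natrM in_cons.
case/orP => [/eqP->|/Hn]; last first.
  by apply: ideal_setMl; apply: prime_square_ideal.
apply: ideal_setMr; first exact: prime_square_ideal.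
by rewrite natrM; apply: ideal_squareM.
Qed.

Lemma prime_squares_coprime (q : set_type (nzPrimeIdeals K))
    (s : seq (set_type (nzPrimeIdeals K))) : q \notin s ->
  exists2 w, (forall p, p \in s -> ideal_square (\val p) w)
    & ideal_square (\val q) (1 - w).
Proof.
move=> qs; have iq2 := prime_square_ideal q.
have cop (p : set_type (nzPrimeIdeals K)) : exists u, p \in s ->
    ideal_square (\val p) u /\ ideal_square (\val q) (1 - u).
  have [ps|nps] := boolP (p \in s); last by exists 0.
  have [|u pu qu] := prime_square_coprime He (val_prime p) (val_prime q).
    by move=> /val_inj pq; move: qs; rewrite -pq ps.
  by exists u.
pose u p := sval (cid (cop p)).
have uP p : p \in s -> ideal_square (\val p) (u p) /\ ideal_square (\val q) (1 - u p).
  by rewrite /u; case: cid.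
exists (\prod_(p <- s) u p).
  move=> p ps; rewrite (big_rem p) //=; apply: ideal_setMr.
    exact: prime_square_ideal.
  by have [] := uP p ps.
rewrite big_seq; elim/big_ind: _ => [|x y qx qy|p /uP[]//].
  by rewrite subrr; apply: ideal_set0.
rewrite (_ : 1 - x * y = (1 - x) * y + (1 - y)); last by ring.
by apply: ideal_setD => //; apply: ideal_setMr.
Qed.

Lemma vcnt_sieve d n (s : seq (set_type (nzPrimeIdeals K))) :
  (1 <= d)%N -> uniq s -> (forall p, p \in s -> ideal_square (\val p) n.+1%:R) ->
  (vcnt e n [set v | forall p, p \in s -> ~ eisenstein_tuples_at d (\val p) v])%:R
    = ((n.+1 ^ k) ^ d.+1)%:R * \prod_(p <- s) (1 - eisenstein_density d p).
Proof.
move=> d1; elim: s => [|q s IH] /= us sn.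
  rewrite big_nil mulr1 -(card_boxset_all K); congr (_%:R); apply: eq_card => f.
  exact/in_boxset.
have [qs {}us] := andP us.
have {}IH := IH us (fun p ps => sn p (mem_behead (s := q :: s) ps)).
have iq := prime_ideal (val_prime q); have iq2 := prime_square_ideal q.
pose J : set o := [set x | forall p, p \in s -> ideal_square (\val p) x].
have iJ : ideal_set J.
  split=> [p ps|x y Jx Jy p ps|a x Jx p ps]; have ip2 := prime_square_ideal p.
  - exact: ideal_set0.
  - by apply: ideal_setB => //; [apply: Jx|apply: Jy].
  - by apply: ideal_setMl => //; apply: Jx.
have [w Jw qw] := prime_squares_coprime qs.
pose S : set 'rV[o]_d.+1 := ~` (eisenstein_tuples_at d (\val q)).
pose T : set 'rV[o]_d.+1 := [set v | forall p, p \in s -> ~ eisenstein_tuples_at d (\val p) v].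
have pS : congr_closed (ideal_square (\val q)) S.
  by apply: congr_closedC => //; apply: eisenstein_tuples_at_congr_closed.
have pT : congr_closed J T.
  move=> v v' vv' Tv p ps.
  have ip := prime_ideal (val_prime p).
  apply: (congr_closedC (ideal_square_ideal ip) (eisenstein_tuples_at_congr_closed ip) _ (Tv p ps)).
  by move=> i; apply: vv'.
have qn : ideal_square (\val q) n.+1%:R by apply: sn; rewrite mem_head.
have Jn : J n.+1%:R by move=> p ps; apply: sn; rewrite in_cons ps orbT.
have /(congr1 (fun x => x%:R : R)) := vcnt_coprime He iq2 iJ qn Jn qw Jw (subrK _ _) pS pT.
have EC := vcntC e n (eisenstein_tuples_at d (\val q)).
have {}EC : (vcnt e n S)%:R =
    ((n.+1 ^ k) ^ d.+1)%:R * (1 - eisenstein_density d q).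
  by rewrite mulrBr mulr1 -vcnt_eisenstein // -EC natrD addrC addKr.
have a0 : ((n.+1 ^ k) ^ d.+1)%:R != 0 :> R by rewrite pnatr_eq0 -lt0n !expn_gt0.
rewrite !natrM EC IH big_cons => E.
have -> : [set v | forall p, p \in q :: s -> ~ eisenstein_tuples_at d (\val p) v] = S `&` T.
  apply/seteqP; split=> v.
    by move=> H; split; [apply: H; rewrite mem_head|move=> p ps; apply: H; rewrite in_cons ps orbT].
  by move=> [Sv Tv] p; rewrite in_cons => /orP[/eqP->|/Tv].
by apply: (mulIf a0); rewrite -E; ring.
Qed.

End EisensteinCounts.

(** * Densities of periodic sets in boxes *)

Lemma card_residue_le M l (D : {set 'I_M}) : (0 < l)%N ->
  {in D &, forall x y : 'I_M, x = y %[mod l]} -> (#|D| <= (M %/ l).+1)%N.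
Proof.
move=> l0 Dl; pose F (x : 'I_M) : 'I_(M %/ l).+1 := inord (x %/ l).
have FE x : F x = (x %/ l)%N :> nat.
  by rewrite inordK // ltnS leq_div2r // ltnW.
rewrite -[X in (_ <= X)%N]card_ord; apply: (leq_card_in F) => x y Dx Dy Fxy.
apply: val_inj; rewrite /= (divn_eq x l) (divn_eq y l) (Dl x y) //.
by rewrite -!FE Fxy.
Qed.

Definition residue_set M n off (r : nat) : {set 'I_M} :=
  [set x : 'I_M | (((x : nat)%:Z - off%:Z) %% n.+1%:Z)%Z == r%:Z]%SET.

Lemma card_residue_set_le M n off r :
  (#|residue_set M n off r| <= (M %/ n.+1).+1)%N.
Proof.
apply: card_residue_le => // x y; rewrite !finset.in_set => /eqP xr /eqP yr.
apply/eqP; rewrite -eqz_nat -!modz_nat eqz_mod_dvd.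
have : ((x : nat)%:Z - off%:Z == (y : nat)%:Z - off%:Z %[mod n.+1%:Z])%Z by rewrite xr yr.
by rewrite eqz_mod_dvd opprB addrA subrK.
Qed.

Lemma card_residue_set_ge M n off r : (r < n.+1)%N ->
  (M %/ n.+1 <= #|residue_set M n off r|)%N.
Proof.
(* The least natural number x with x - off congruent to r; the class continues from it in steps of
   n+1. *)
move=> rn; pose s := ((off + r) %% n.+1)%N.
have lts (y : 'I_(M %/ n.+1)) : (s + y * n.+1 < M)%N.
  apply: (@leq_trans (y.+1 * n.+1)).
    by rewrite mulSn ltn_add2r ltn_pmod.
  by apply: leq_trans (leq_trunc_div M n.+1); rewrite leq_mul2r ltn_ord orbT.
pose F y := Ordinal (lts y).
rewrite -[X in (X <= _)%N]card_ord -cardsT -(card_imset (f := F)); last first.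
  move=> x y /(congr1 val) /= /eqP; rewrite eqn_add2l eqn_pmul2r // => /eqP.
  exact: val_inj.
apply/subset_leq_card/fintype.subsetP => _ /imsetP[y _ ->].
rewrite finset.in_set /=.
have -> : (s + y * n.+1)%:Z - off%:Z = (y%:Z - ((off + r) %/ n.+1)%:Z) * n.+1%:Z + r%:Z.
  by have := divn_eq (off + r) n.+1; rewrite -/s; lia.
by rewrite modzMDl modz_small.
Qed.

Section BoxDensity.
Variables (R : realType) (K : fieldExtType rat).
Local Notation o := (ringOfIntegers K).
Local Notation k := (\dim {:K}).
Variables (e : 'I_k -> o) (He : integral_basis e).

(** The tuples of the box in a given class modulo n+1 form a product of m k residue classes in
    intervals of M consecutive integers, each with either the floor of M/(n+1) or one more
    element. *)
Lemma card_boxset_congr_closed M off m n (S : set 'rV[o]_m) :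
  congr_closed (principal n.+1%:R) S ->
  (vcnt e n S * (M %/ n.+1) ^ (m * k) <= #|boxset e M off S|
     <= vcnt e n S * (M %/ n.+1).+1 ^ (m * k))%N.
Proof.
move=> pS.
pose r (f : {ffun 'I_m -> {ffun 'I_k -> 'I_M}}) := vresi He n (vpt e off f).
have rS f : S (vpt e off f) <-> S (vpt e 0 (r f)).
  apply: (congr_closedP (principal_ideal _) pS).
  by apply: vresi_congr; [exact: principal_ideal|exists 1; rewrite mulr1].
pose fib (g : {ffun 'I_m -> {ffun 'I_k -> 'I_n.+1}}) :=
  family (fun i => mem (family (fun j => mem (residue_set M n off (g i j))))).
have rfib f g : (r f == g) = (f \in fib g).
  apply/eqP/familyP => [<- i|H].
    apply/familyP => j /=; rewrite finset.in_set ffunE mxE resiE zlinK.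
    exact: eqxx.
  apply/ffunP => i; apply/ffunP => j; apply/val_inj/eqP; rewrite -eqz_nat ffunE mxE resiE zlinK.
  by have /familyP /(_ j) := H i; rewrite /= finset.in_set.
have cfib g : #|fib g| = (\prod_i \prod_j #|residue_set M n off (g i j)|)%N.
  rewrite card_family foldrE big_map big_enum; apply: eq_bigr => i _.
  by rewrite [LHS]card_family foldrE big_map big_enum.
have cbox : #|boxset e M off S| = (\sum_(g in boxset e n.+1 0 S) #|fib g|)%N.
  rewrite -sum1_card (partition_big r (mem (boxset e n.+1 0 S))) /=.
    apply: eq_bigr => g /in_boxset Sg; rewrite -sum1_card; apply: eq_bigl => f.
    rewrite -rfib; case: eqP => [E|]; rewrite ?andbF // andbT.
    by apply/in_boxset/rS; rewrite E.
  by move=> f /in_boxset/rS ?; apply/in_boxset.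
have card_mk c : (\prod_(i < m) \prod_(j < k) c)%N = (c ^ (m * k))%N.
  by rewrite !prod_nat_const !card_ord -expnM mulnC.
rewrite cbox /vcnt -!sum_nat_const -!card_mk; apply/andP; split; apply: leq_sum => g _;
  rewrite cfib; apply: leq_prod => i _; apply: leq_prod => j _.
  exact: card_residue_set_ge.
exact: card_residue_set_le.
Qed.

Lemma cvg_inv_double : ((2 * H%:R)^-1 : R) @[H --> \oo] --> (0 : R).
Proof.
apply/gtr0_cvgV0.
  by exists 1%N => // H /= H1; rewrite mulr_gt0 // ltr0n.
apply/cvgryPge => A; have := @cvgr_idn R; move/cvgryPge/(_ A).
apply: filterS => H AH; apply: le_trans AH _.
by rewrite ler_peMl // ler1n.
Qed.

Lemma boxset_density m n (S : set 'rV[o]_m) :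
  congr_closed (principal n.+1%:R) S ->
  (#|boxset e (2 * H) H S|%:R / (2 * H%:R) ^+ (m * k) : R) @[H --> \oo]
    --> ((vcnt e n S)%:R / ((n.+1 ^ k) ^ m)%:R : R).
Proof.
move=> pS; set V : R := (vcnt e n S)%:R.
(* With x = 1/(2H), c = -1 and c = 1 give the lower and upper bounds, as rounding changes 1/(n+1) by
   at most 1/(2H). Both are polynomials in x with the same value at 0. *)
pose h (c x : R) := V * (n.+1%:R^-1 + c * x) ^+ (m * k).
have h0 c : h c 0 = V / ((n.+1 ^ k) ^ m)%:R.
  by rewrite /h mulr0 addr0 exprVn -expnM [(k * m)%N]mulnC natrX.
have hcvg c : h c (2 * H%:R)^-1 @[H --> \oo] --> (V / ((n.+1 ^ k) ^ m)%:R : R).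
  rewrite -(h0 c); apply: continuous_cvg; last exact: cvg_inv_double.
  rewrite /h; apply: cvgM; first exact: cvg_cst.
  apply: (@cvg_comp _ _ _ (fun x : R => n.+1%:R^-1 + c * x) (fun y => y ^+ (m * k)));
    last exact: exprn_continuous.
  apply: cvgD; first exact: cvg_cst.
  by apply: cvgM; [exact: cvg_cst|exact: cvg_id].
apply: (squeeze_cvgr _ (hcvg (-1)) (hcvg 1)).
(* From here on 1/(n+1) - 1/(2H) is non-negative, so that raising it to a power preserves the
   inequality. *)
exists n.+1 => // H /= nH.
have n0 : 0 < n.+1%:R :> R by rewrite ltr0n.
have H0 : 0 < 2 * H%:R :> R by rewrite mulr_gt0 // ltr0n (leq_trans _ nH).
have /andP[lo up] := @card_boxset_congr_closed (2 * H) H _ _ _ pS.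
have D0 : 0 < (2 * H%:R) ^+ (m * k) :> R by rewrite exprn_gt0.
rewrite ler_pdivlMr // ler_pdivrMr // /h -!mulrA -!exprMn.
move: lo up; rewrite -!(ler_nat R) !natrM !natrX -/V => lo up.
have V0 : 0 <= V by [].
apply/andP; split; [apply: le_trans lo|apply: (le_trans up)];
  apply: ler_wpM2l => //; apply: lerXn2r; rewrite ?nnegrE //.
- rewrite mulr_ge0 ?(ltW H0) // mulN1r subr_ge0 lef_pV2 ?posrE //.
  by rewrite -natrM ler_nat (leq_trans nH) // leq_pmull.
- rewrite mulN1r mulrBl mulVf ?gt_eqF // lerBlDr.
  rewrite ler_pdivrMl // natr1 -!natrM ler_nat.
  by rewrite [leqRHS]mulnC ltnW // ltn_ceil.
- rewrite mul1r mulrDl mulVf ?gt_eqF // -natr1 lerD2r.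
  by rewrite ler_pdivlMl // -!natrM ler_nat mulnC leq_trunc_div.
Qed.

End BoxDensity.

(** * Primes of large norm *)

Lemma card_le_cover (T : finType) (I : eqType) (s : seq I) (P : pred I)
    (A : {set T}) (F : I -> {set T}) :
  (forall x, x \in A -> exists2 i, i \in s & P i && (x \in F i)) ->
  (#|A| <= \sum_(i <- s | P i) #|F i|)%N.
Proof.
move=> AF; apply: (@leq_trans #|(\bigcup_(i <- s | P i) F i)%SET|).
  apply/subset_leq_card/fintype.subsetP => x /AF[i si /andP[Pi xi]].
  rewrite (big_rem i) //= Pi; apply/finset.setUP; by left.
elim/big_rec2: _ => [|i m B _ Bm]; first by rewrite cards0.
by apply: leq_trans (leq_card_setU _ _) _; rewrite leq_add2l.
Qed.

Lemma card_first_two (T : finType) d (D0 D1 : {set T}) :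
  #|[set F : {ffun 'I_d.+2 -> T} | (F ord0 \in D0) && (F (lift ord0 ord0) \in D1)]%SET|
    = (#|D0| * #|D1| * #|T| ^ d)%N.
Proof.
pose G (i : 'I_d.+2) : {set T} :=
  if i == ord0 then D0 else if i == lift ord0 ord0 then D1 else finset.setT.
transitivity #|family (fun i => mem (G i))|.
  apply: eq_card => F; rewrite finset.in_set; apply/andP/familyP => [[F0 F1] i /=|FG].
    rewrite /G; case: eqP => [->//|_]; case: eqP => [->//|_].
    by rewrite finset.in_setT.
  by split; [have := FG ord0|have := FG (lift ord0 ord0)]; rewrite /G /= ?eqxx.
rewrite card_family foldrE big_map big_enum !big_ord_recl /= mulnA; congr (_ * _)%N.
rewrite (eq_bigr (fun=> #|T|)) ?big_const_ord ?iter_muln ?muln1 // => i _.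
by rewrite -cardsT; apply: eq_card.
Qed.

(** Telescoping: 1/x - 1/(x+1) exceeds 1/(x+1)^2 by 1/(x (x+1)^2). *)
Lemma sum_inv_sq (R : realFieldType) L M : (0 < L)%N ->
  \sum_(L.+1 <= l < M.+1) (l%:R ^+ 2)^-1 <= L%:R^-1 :> R.
Proof.
move=> L0; have L0' : 0 < L%:R :> R by rewrite ltr0n.
have [ML|/ltnW/subnKC <-] := leqP M L; first by rewrite big_geq ?invr_ge0 ?ler0n.
suff : \sum_(L.+1 <= l < (L + (M - L)).+1) (l%:R ^+ 2)^-1
    <= L%:R^-1 - (L + (M - L))%:R^-1 :> R.
  by move/le_trans; apply; rewrite gerBl invr_ge0 ler0n.
elim: (M - L)%N => [|n IH]; first by rewrite addn0 subrr big_geq.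
rewrite addnS big_nat_recr /=; last by rewrite ltnS leq_addr.
have x0 : 0 < (L + n)%:R :> R by rewrite ltr0n ltn_addr.
rewrite -natr1; move: x0 IH; set x : R := (L + n)%:R; set y := L%:R^-1 => x0 IH; clearbody x y.
rewrite (le_trans (lerD IH (lexx _))) // -addrA lerD2l.
rewrite -subr_ge0 (_ : _ - _ = (x * (x + 1) ^+ 2)^-1).
  by rewrite invr_ge0 mulr_ge0 ?sqr_ge0 // ltW.
have x1 : 0 < x + 1 by rewrite addr_gt0.
by field; rewrite (lt0r_neq0 x0) (lt0r_neq0 x1).
Qed.

(** The product of the selected prime divisors is at most n, and each is at least M. Thus a norm
    bounded by M^(k+1) has at most k+1 prime divisors above M when M > 1. *)
Lemma expn_size_primes_le n (P : pred nat) M : (0 < n)%N ->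
  (forall l, P l -> (M <= l)%N) -> (M ^ size [seq l <- primes n | P l] <= n)%N.
Proof.
move=> n0 PM; rewrite size_filter -[X in (X <= _)%N]muln1 -iter_muln -big_const_seq.
rewrite [leqRHS](prod_prime_decomp n0) prime_decompE big_map big_mkcond /=.
rewrite big_seq [leqRHS]big_seq; apply: leq_prod => l.
rewrite -logn_gt0 => l0; case: ifP => [/PM Ml|_].
  by apply: leq_trans Ml _; rewrite -{1}[l]expn1 leq_pexp2l //; case: l l0.
by rewrite expn_gt0; case: l l0.
Qed.

Section Tail.
Variables (K : fieldExtType rat).
Local Notation o := (ringOfIntegers K).
Local Notation k := (\dim {:K}).
Variables (e : 'I_k -> o) (He : integral_basis e).
Implicit Types (p : set o) (M off d l L : nat).

Definition boxpts M off (B : set o) : {set {ffun 'I_k -> 'I_M}} :=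
  [set f | `[< B (pt e off f) >]]%SET.

Lemma in_boxpts M off B f : reflect (B (pt e off f)) (f \in boxpts M off B).
Proof. exact: in_set_asbool. Qed.

(* As [e i0] is not in [p], the [i0]-th coordinate of a point of [p] is
   determined modulo [l] by the other coordinates. *)
Lemma card_prime_boxpts p l M off : nzPrimeIdeals K p -> prime l -> p l%:R ->
  (#|boxpts M off p| * M <= M ^ k * (M %/ l).+1)%N.
Proof.
move=> pp lp pl; have ip := prime_ideal pp.
have [i0 npi0] : exists i0, ~ p (e i0).
  apply: contrapT => H; apply: (prime_ideal1 pp); rewrite -(zcoordK He 1) /zlin.
  apply: ideal_set_sum => // i _; rewrite -mulrzr; apply: ideal_setMr => //.
  by apply: contrapT => npi; apply: H; exists i.
have [l' l'p l'P] := prime_ideal_char He pp.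
have lP c : p c%:~R -> (l%:Z %| c)%Z.
  have /eqP <- : l' == l by rewrite -dvdn_prime2 // -[(_ %| _)%N]/((l'%:Z %| l%:Z)%Z); apply/l'P.
  by move/l'P.
pose T : finType := {ffun 'I_k -> 'I_M}.
(* Coordinate i0 is overwritten by a free value rather than deleted, whence the factor M on the
   left; the old coordinate survives only through its quotient by l, its residue being forced by
   membership in p. *)
pose G (u : T * 'I_M) : T * 'I_(M %/ l).+1 :=
  ([ffun j => if j == i0 then u.2 else u.1 j], inord (u.1 i0 %/ l)).
have <- : #|finset.setX (boxpts M off p) [set: 'I_M]%SET| = (#|boxpts M off p| * M)%N.
  by rewrite finset.cardsX finset.cardsT card_ord.
have <- : #|{: T * 'I_(M %/ l).+1}| = (M ^ k * (M %/ l).+1)%N.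
  by rewrite card_prod card_ffun !card_ord.
apply: (leq_card_in G) => -[f x] [g y].
rewrite !finset.in_setX => /andP[/in_boxpts pf _] /andP[/in_boxpts pg _] E.
have /ffunP E1 : (G (f, x)).1 = (G (g, y)).1 by rewrite E.
have E2 : (G (f, x)).2 = (G (g, y)).2 by rewrite E.
have Efg j : j != i0 -> f j = g j.
  by move=> /negPf ji; have := E1 j; rewrite !ffunE /= ji.
have Exy : x = y by have := E1 i0; rewrite !ffunE /= eqxx.
have Ediv : (f i0 %/ l = g i0 %/ l)%N.
  have dl (h : T) : (h i0 %/ l < (M %/ l).+1)%N by rewrite ltnS leq_div2r // ltnW.
  by move: (congr1 val E2); rewrite /= !inordK.
have Emod : f i0 = g i0 %[mod l].
  apply/eqP; rewrite -eqz_nat -!modz_nat eqz_mod_dvd.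
  apply: lP; have := ideal_setB ip pf pg; rewrite /pt -zlinB /zlin (bigD1 i0) //= big1.
    rewrite addr0 opprB addrA subrK -mulrzr => /(prime_idealM pp)[/npi0//|].
    by rewrite addrC.
  by move=> j ji; rewrite Efg // subrr mulr0z.
congr (_, _) => //; apply/ffunP => j; have [->|/Efg//] := eqVneq j i0.
by apply: val_inj; rewrite /= (divn_eq (f i0) l) (divn_eq (g i0) l) Ediv Emod.
Qed.

(** A duplicate-free list of primes over l of maximal length exists by the bound k, and it is
    complete because a missing prime could be added to it. *)
Lemma primes_over l : prime l ->
  exists s : seq (set o), [/\ (size s <= k)%N,
    forall p, p \in s -> nzPrimeIdeals K p /\ p l%:R
    & forall p, nzPrimeIdeals K p -> p l%:R -> p \in s].
Proof.
move=> lp.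
pose Q n := `[< exists s : seq (set o), [/\ size s = n, uniq s &
  forall p, p \in s -> nzPrimeIdeals K p /\ p l%:R] >].
have exQ : exists n, Q n by exists 0%N; apply/asboolP; exists [::].
have bQ n : Q n -> (n <= k)%N.
  by move=> /asboolP[s [<- us sP]]; apply: (size_primes_over He lp us sP).
case: (ex_maxnP exQ bQ) => n /[dup] Qn /asboolP[s [sn us sP]] nmax.
exists s; split=> //; first by rewrite sn bQ.
move=> p pp pl; apply: contraT => nps; have := nmax n.+1; rewrite ltnn; apply.
apply/asboolP; exists (p :: s); split; rewrite /= ?sn ?nps // => q.
by rewrite in_cons => /orP[/eqP->//|/sP].
Qed.

End Tail.

Lemma ler_sum_size (R : realFieldType) (I : eqType) (s : seq I) (F : I -> R) c n :
  0 <= c -> (forall i, i \in s -> F i <= c) -> (size s <= n)%N ->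
  \sum_(i <- s) F i <= c * n%:R.
Proof.
move=> c0 Fc sn; apply: (@le_trans _ _ (c * (size s)%:R)); last first.
  by rewrite ler_wpM2l // ler_nat.
elim: s Fc {sn} => [|i s IH] Fc; first by rewrite big_nil mulr0.
rewrite big_cons /= -natr1 mulrDr mulr1 addrC lerD //.
  by apply: IH => j js; apply: Fc; rewrite in_cons js orbT.
by apply: Fc; rewrite mem_head.
Qed.

(** * Uniform bound for the contribution of large primes *)

Section TailBound.
Variables (R : realType) (K : fieldExtType rat).
Local Notation o := (ringOfIntegers K).
Local Notation k := (\dim {:K}).
Variables (e : 'I_k -> o) (He : integral_basis e).
Implicit Types (p : set o) (M d l L H : nat).

(** A relaxation of being Eisenstein at a prime over some l > L, retaining only what is needed of
    a_0 and a_1. Since p contains exactly one rational prime, the universal condition on l says that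
    this prime exceeds L. *)
Definition large_common_prime d L : set 'rV[o]_d.+2 :=
  [set v | v 0 ord0 != 0 /\ exists p, [/\ nzPrimeIdeals K p,
     forall l, prime l -> p l%:R -> (L < l)%N,
     p (v 0 ord0) & p (v 0 (lift ord0 ord0))]].

Arguments large_common_prime d L _ : clear implicits.

(** The factor 2 absorbs the rounding: for l <= M, the floor of M/l plus 1 is at most 2M/l. *)
Lemma card_prime_boxpts_small p l M off : (l <= M)%N ->
  nzPrimeIdeals K p -> prime l -> p l%:R ->
  #|boxpts e M off p|%:R <= 2 * (M ^ k)%:R / l%:R :> R.
Proof.
move=> lM pp lp pl; have := card_prime_boxpts He M off pp lp pl.
have l0 := prime_gt0 lp; have M0 := leq_trans l0 lM.
rewrite ler_pdivlMr ?ltr0n // -!natrM ler_nat => DM.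
rewrite -(leq_pmul2r M0) mulnAC (leq_trans (leq_mul DM (leqnn l))) //.
rewrite -mulnA -[leqRHS]mulnA [leqRHS]mulnCA leq_mul2l mulSn [(2 * M)%N]mul2n -addnn.
by rewrite leq_add ?orbT // leq_trunc_div.
Qed.

Lemma card_prime_boxpts_large p l M off : (0 < M < l)%N ->
  nzPrimeIdeals K p -> prime l -> p l%:R ->
  #|boxpts e M off p|%:R <= (M ^ k)%:R / M%:R :> R.
Proof.
move=> /andP[M0 Ml] pp lp pl; have := card_prime_boxpts He M off pp lp pl.
by rewrite divn_small // muln1 ler_pdivlMr ?ltr0n // -natrM ler_nat.
Qed.

(** Once 2H reaches the constant of [absnorm_bound], one further factor 2H absorbs it. *)
Lemma absnorm_pt_bound : exists M0, forall H (f : {ffun 'I_k -> 'I_(2 * H)}),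
  (M0 <= 2 * H)%N -> (absnorm He (pt e H f) <= (2 * H) ^ k.+1)%N.
Proof.
have [C CP] := absnorm_bound He; exists C => H f CH.
rewrite expnS; apply: leq_trans (leq_mul CH (leqnn _)); apply: CP => j.
by have := ltn_ord (f j); lia.
Qed.

(** For L < l <= M, at most k primes over l, each with proportion (2/l)^2, sum to at most 4k/L. For
    l > M, each a_0 leaves at most k+1 values of l, hence k(k+1) primes, each of which admits a
    proportion 1/M of the a_1. *)
Lemma large_common_prime_bound : exists M0, forall d L H,
  (0 < L)%N -> (0 < H)%N -> (M0 <= 2 * H)%N ->
  #|boxset e (2 * H) H (large_common_prime d L)|%:R
    <= ((4 * k)%:R / L%:R + (k * k.+1)%:R / (2 * H)%:R) * (((2 * H) ^ k) ^ d.+2)%:R :> R.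
Proof.
have sq_alg (x y z : R) : y != 0 ->
    4 * (x * x * z) * y ^- 2 = (2 * x / y) * (2 * x / y) * z by move=> y0; field.
have lin_alg (x y z w : R) : x * y / z * w = x * w * z^-1 * y by ring.
have tail_alg (x y z u w : R) : x * (x / y * z * u * w) = u * w / y * (x * x * z) by ring.
have [M0 M0P] := absnorm_pt_bound; exists M0 => d L H L0 H0 MH.
have exs l : exists s : seq (set o), prime l -> [/\ (size s <= k)%N,
    forall p, p \in s -> nzPrimeIdeals K p /\ p l%:R
    & forall p, nzPrimeIdeals K p -> p l%:R -> p \in s].
  have [lp|//] := boolP (prime l); last by exists [::].
  by have [s sP] := primes_over He lp; exists s.
pose s l := sval (cid (exs l)).
have sP l : prime l -> [/\ (size (s l) <= k)%N,
    forall p, p \in s l -> nzPrimeIdeals K p /\ p l%:R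
    & forall p, nzPrimeIdeals K p -> p l%:R -> p \in s l].
  by rewrite /s; case: cid.
set M := (2 * H)%N in MH *.
have M_gt0 : (0 < M)%N by rewrite muln_gt0.
have M1 : (1 < M)%N by rewrite /M; lia.
pose T : finType := {ffun 'I_k -> 'I_M}.
pose A (p : set o) (D : {set T}) : {set {ffun 'I_d.+2 -> T}} :=
  [set F : {ffun 'I_d.+2 -> T} | (F ord0 \in D)
     && (F (lift ord0 ord0) \in boxpts e M H p)]%SET.
have cT : #|T| = (M ^ k)%N by rewrite card_ffun !card_ord.
have cA p D : #|A p D|%:R = #|D|%:R * #|boxpts e M H p|%:R * (M ^ k)%:R ^+ d :> R.
  by rewrite card_first_two cT !natrM natrX.
set W : R := (((2 * H) ^ k) ^ d.+2)%:R.
set t : R := (M ^ k)%:R.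
have t0 : 0 <= t by rewrite ler0n.
have WE : W = t * t * t ^+ d by rewrite /W /t natrX !exprS mulrA.
have Mr0 : 0 < M%:R :> R by rewrite ltr0n.
pose ps (b : T) := [seq l <- primes (absnorm He (pt e H b)) | (M < l)%N].
(* [Z1] lets the prime vary first, over a range of l depending on the box; [Z2] fixes a_0 = b first,
   so that only primes over divisors of its norm occur. *)
pose Z1 := [seq A p (boxpts e M H p) | l <- [seq l <- index_iota L.+1 M.+1 | prime l], p <- s l].
pose Z2b (b : T) := [seq A p [set b]%SET | l <- ps b, p <- s l].
pose Z2 := flatten [seq Z2b b | b <- enum [pred b : T | pt e H b != 0]].
have cover : (#|boxset e M H (large_common_prime d L)| <= \sum_(X <- Z1 ++ Z2) #|X|)%N.
  apply: card_le_cover => F /in_boxset[F0 [p [pp pL p0 p1]]].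
  rewrite !mxE in F0 p0 p1.
  have [l lp lP] := prime_ideal_char He pp.
  have pl : p l%:R by apply/(lP l); apply: dvdzz.
  have [_ _ ps_l] := sP l lp.
  have [lM|Ml] := leqP l M.
    exists (A p (boxpts e M H p)).
      rewrite mem_cat; apply/orP; left; apply/allpairsPdep; exists l, p; split=> //.
        by rewrite mem_filter lp mem_index_iota ltnS lM pL.
      exact: ps_l.
    by rewrite finset.in_set /=; apply/andP; split; apply/in_boxpts.
  exists (A p [set F ord0]%SET).
    rewrite mem_cat; apply/orP; right; apply/flattenP; exists (Z2b (F ord0)).
      by apply: map_f; rewrite mem_enum.
    apply/allpairsPdep; exists l, p; split=> //; last exact: ps_l.
    rewrite mem_filter Ml mem_primes lp absnorm_gt0 //=.
    have [y Ey] := absnorm_dvd He (pt e H (F ord0)).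
    have /(lP (absnorm He (pt e H (F ord0)))) // : p (absnorm He (pt e H (F ord0)))%:R.
    by rewrite Ey; apply: ideal_setMl => //; apply: prime_ideal.
  by rewrite finset.in_set /= finset.in_set1 eqxx /=; apply/in_boxpts.
move: cover; rewrite -(ler_nat R) natr_sum big_cat /= => /le_trans; apply.
rewrite mulrDl; apply: lerD.
  rewrite big_allpairs_dep big_filter.
  apply: (@le_trans _ _ (\sum_(L.+1 <= l < M.+1 | prime l) 4 * W * (l%:R ^+ 2)^-1 * k%:R)).
    rewrite big_nat_cond [leRHS]big_nat_cond; apply: ler_sum => l /andP[/andP[_]].
    rewrite ltnS => lM lp.
    have [sk sl _] := sP l lp; have l0 : 0 < l%:R :> R by rewrite ltr0n prime_gt0.
    apply: ler_sum_size => // [|p /sl[pp pl]].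
      by rewrite mulr_ge0 ?invr_ge0 ?exprn_ge0 ?mulr_ge0 ?ler0n.
    rewrite cA WE; have := card_prime_boxpts_small H lM pp lp pl.
    rewrite -/t; set D : R := _%:R => Dt.
    rewrite sq_alg ?gt_eqF //.
    by rewrite ler_wpM2r ?exprn_ge0 // ler_pM // ler0n.
  rewrite -mulr_suml -mulr_sumr.
  rewrite natrM lin_alg.
  rewrite ler_wpM2r ?ler0n // ler_wpM2l ?mulr_ge0 ?ler0n //.
  apply: le_trans (sum_inv_sq R M L0); rewrite big_mkcond /=; apply: ler_sum => l _.
  by case: ifP; rewrite // invr_ge0 exprn_ge0.
rewrite big_flatten big_map big_enum_cond /=.
apply: (@le_trans _ _ (\sum_(b : T) t / M%:R * t ^+ d * k%:R * k.+1%:R)); last first.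
  by rewrite sumr_const cT -[_ *+ (M ^ k)%N]mulr_natl -/t WE natrM tail_alg.
rewrite [leLHS]big_mkcond /=; apply: ler_sum => b _.
have c0 : 0 <= t / M%:R * t ^+ d by rewrite mulr_ge0 ?exprn_ge0 // divr_ge0 ?ler0n.
case: ifP => [b0|_]; last exact: mulr_ge0 (mulr_ge0 c0 (ler0n _ _)) (ler0n _ _).
rewrite big_allpairs_dep; apply: ler_sum_size => [|l|].
- exact: mulr_ge0 c0 (ler0n _ _).
- rewrite mem_filter mem_primes => /andP[Ml /and3P[lp _ _]].
  have [sk sl _] := sP l lp.
  apply: ler_sum_size => // p /sl[pp pl]; rewrite cA cards1 mul1r.
  rewrite ler_wpM2r ?exprn_ge0 //.
  by apply: card_prime_boxpts_large pl; rewrite ?M_gt0.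
- rewrite -(leq_exp2l _ _ M1); apply: leq_trans (M0P H b MH).
  apply: expn_size_primes_le; first by apply: absnorm_gt0; case/andP: b0.
  by move=> l /ltnW.
Qed.

End TailBound.

Arguments large_common_prime {K} d L _.

(** * The Eisenstein density *)

(** The limit P is the infimum of the partial products, which decrease as J grows. The last two
    clauses are the form in which the density argument uses the convergence. *)
Lemma has_prod_contraction (R : realType) (I : choiceType) (f : I -> R) :
  (forall i, 0 <= f i <= 1) ->
  exists P : R, [/\ has_prod f P,
    forall J : {fset I}, P <= \prod_(i <- J) f i
    & forall eps, 0 < eps -> exists J0 : {fset I}, forall J : {fset I},
        (J0 `<=` J)%fset -> \prod_(i <- J) f i < P + eps].
Proof.
move=> f01; pose F (J : {fset I}) := \prod_(i <- J) f i.
have F0 J : 0 <= F J by apply: prodr_ge0 => i _; case/andP: (f01 i).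
have Fle (J J' : {fset I}) : (J `<=` J')%fset -> F J' <= F J.
  move=> JJ'; rewrite /F (big_fsetID _ (mem J)) /=.
  have -> : [fset x in J' | x \in J]%fset = J.
    by apply/fsetP => x; rewrite !inE /=;
      case: (boolP (x \in J)) => [/(fsubsetP JJ')->|]; rewrite ?andbF.
  by apply: ler_piMr; [exact: F0|exact: prodr_ile1].
have hi : has_inf (range F).
  by split; [exists (F fset0), fset0|exists 0 => _ [J _ <-]].
pose P := inf (range F).
have PF J : P <= F J by apply: ge_inf; [exact: hi.2|exists J].
have Peps eps : 0 < eps -> exists J0 : {fset I}, forall J : {fset I},
    (J0 `<=` J)%fset -> F J < P + eps.
  move=> eps0; have [_ [J0 _ <-] J0P] := inf_adherent eps0 hi.
  by exists J0 => J JJ; apply: le_lt_trans (Fle _ _ JJ) J0P.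
exists P; split=> //; have FF := @summability.totally_filter I; apply/cvgrPdist_lt => eps eps0.
have [J0 J0P] := Peps _ eps0; exists J0 => // J /= JJ.
by rewrite ler0_norm ?subr_le0 ?PF // opprB ltrBlDl J0P.
Qed.

Section Conclusion.
Variables (R : realType) (K : fieldExtType rat).
Local Notation o := (ringOfIntegers K).
Local Notation k := (\dim {:K}).

Lemma eisenstein_density_contraction d (p : set_type (nzPrimeIdeals K)) :
  0 <= 1 - eisenstein_density R d p <= 1.
Proof.
rewrite subr_ge0 gerBl /eisenstein_density; set N := idealNorm p.
(* Finiteness of the quotient was derived from an integral basis, and none is given here. For norm 0
   the convention that 0 has inverse 0 makes the factor equal to 1. *)
have [->|N0] := posnP N; first by rewrite expr0n addn2 /= invr0 mulr0 lexx ler01.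
have N1 : 1 <= N%:R :> R by rewrite ler1n.
have Nd : 0 < N%:R ^+ (d + 2) :> R by rewrite exprn_gt0 // ltr0n.
rewrite ler_pdivrMr // mul1r divr_ge0 ?exprn_ge0 ?ler0n ?subr_ge0 // andbT.
rewrite exprD -[leLHS]mul1r ler_pM ?exprn_ege1 ?exprn_ge0 ?subr_ge0 //.
by rewrite lerXn2r ?nnegrE ?subr_ge0 ?ler0n // gerBl.
Qed.

Variables (e : 'I_k -> o) (He : integral_basis e).

(** Adding H identifies the integers of [-H, H) with ['I_(2 * H)], and uniqueness of coordinates
    makes [vpt] injective. *)
Lemma box_countE m (T : set 'rV[o]_m) H :
  box_count T e H = #|boxset e (2 * H) H T|.
Proof.
pose V := @vpt K e m (2 * H) H.
have Vinj : injective V.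
  move=> f g fg; apply/ffunP => i; apply/ffunP => j.
  have /(congr1 (fun x => zcoord He x j)) : pt e H (f i) = pt e H (g i).
    by move/rowP/(_ i): fg; rewrite !mxE.
  by rewrite !zlinK => /addIr [] /val_inj.
have AE : T `&` [set v | forall i, box e H (v 0 i)] = V @` [set f | f \in boxset e (2 * H) H T].
  apply/seteqP; split=> [v [Tv vbox]|_ [f /in_boxset Tf <-]].
    have bc i j : - H%:Z <= zcoord He (v 0 i) j < H%:Z.
      by have [a [aH ->]] := vbox i; rewrite zlinK.
    have lt i j : (absz (zcoord He (v 0 i) j + H%:Z)%R < 2 * H)%N by have := bc i j; lia.
    pose f := [ffun i => [ffun j => Ordinal (lt i j)]].
    have Vf : V f = v.
      apply/rowP => i; rewrite mxE -[RHS](zcoordK He); apply: eq_bigr => j _.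
      by congr (_ *~ _); rewrite !ffunE /=; have := bc i j; lia.
    by exists f => //=; apply/in_boxset; rewrite -/V Vf.
  split=> // i; exists (fun j => (f i j : nat)%:Z - H%:Z); split; last by rewrite mxE.
  by move=> j; have := ltn_ord (f i j); lia.
rewrite /box_count AE.
have fin : finite_set (V @` [set f | f \in boxset e (2 * H) H T]).
  by apply: finite_image; apply: finite_finset.
rewrite -[RHS](size_image V).
apply: perm_size; apply: uniq_perm; first exact: fset_uniq.
  by rewrite map_inj_uniq // enum_uniq.
move=> v; rewrite in_fset_set //; apply/idP/mapP.
  by rewrite inE => -[f fT <-]; exists f => //; rewrite mem_enum.
by move=> [f fT ->]; rewrite inE; exists f => //=; rewrite mem_enum in fT.
Qed.

Lemma small_primes L : exists J : seq (set_type (nzPrimeIdeals K)),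
  forall (p : set_type (nzPrimeIdeals K)) l,
    prime l -> \val p l%:R -> (l <= L)%N -> p \in J.
Proof.
elim: L => [|L [J JP]].
  by exists [::] => p [|l].
have [lp|nlp] := boolP (prime L.+1); last first.
  exists J => p l lp pl; rewrite leq_eqVlt => /orP[/eqP lL|]; last exact: JP lp pl.
  by rewrite -lL lp in nlp.
have [s [_ _ sP]] := primes_over He lp.
exists (pmap insub s ++ J) => p l lp' pl; rewrite leq_eqVlt mem_cat => /orP[/eqP lL|lL].
  by rewrite mem_pmap_sub; apply/orP; left; apply: sP; rewrite -?lL //; apply: val_prime.
by apply/orP; right; apply: JP lp' pl lL.
Qed.

(** A sandwich: the Eisenstein tuples contain the complement of S, which consists of those
    Eisenstein at some p in J, and exceed it only within [large_common_prime]. *)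
Lemma eisenstein_has_density d (P : R) : (2 <= d)%N ->
  (forall J : {fset set_type (nzPrimeIdeals K)},
     P <= \prod_(p <- J) (1 - eisenstein_density R d p)) ->
  (forall eps, 0 < eps -> exists J0 : {fset set_type (nzPrimeIdeals K)},
     forall J : {fset set_type (nzPrimeIdeals K)}, (J0 `<=` J)%fset ->
     \prod_(p <- J) (1 - eisenstein_density R d p) < P + eps) ->
  density_wrt e (eisenstein_tuples (d := d)) (1 - P).
Proof.
case: d => [//|[//|d]] _ PJ Peps.
pose T := eisenstein_tuples (d := d.+2) (K := K).
pose W H : R := (((2 * H) ^ k) ^ d.+3)%:R.
have WE H : (2 * H%:R) ^+ (d.+3 * k) = W H by rewrite /W -expnM mulnC natrX natrM.
apply/cvgrPdist_le => eps eps0.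
(* Four errors share eps: the partial product against P, the proportion of S in the box against its
   density, and the two terms of the tail bound. *)
have eps4 : 0 < eps / 4 by rewrite divr_gt0.
have [J0 J0P] := Peps _ eps4.
pose L := (Num.bound ((4 * k)%:R / (eps / 4) : R)).+1.
have LP : (4 * k)%:R / L%:R <= eps / 4.
  rewrite ler_pdivrMr ?ltr0n // mulrC -ler_pdivrMr //.
  by rewrite (le_trans (ltW (archi_boundP _))) ?ler_nat // divr_ge0 ?ler0n // ltW.
have [JL JLP] := small_primes L.
pose J := (J0 `|` [fset p in JL])%fset.
have [n Jn] := exists_square_multiple He J.
pose S : set 'rV[o]_d.+3 :=
  [set v | forall p, p \in (J : seq _) -> ~ eisenstein_tuples_at d.+2 (\val p) v].
have pS : congr_closed (principal n.+1%:R) S.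
  move=> v w vw Sv p pJ; have ip := prime_ideal (val_prime p).
  apply: (congr_closedC (prime_square_ideal p) (eisenstein_tuples_at_congr_closed ip) _ (Sv p pJ)).
  by move=> i; have [z ->] := vw i; apply: ideal_setMr; [exact: prime_square_ideal|exact: Jn].
have piP : P <= \prod_(p <- J) (1 - eisenstein_density R d.+2 p) < P + eps / 4.
  by rewrite PJ J0P // fsubsetUl.
have Slim := @boxset_density R _ _ He _ _ _ pS.
rewrite (vcnt_sieve R He _ (fset_uniq _) Jn) // mulrAC divff ?mul1r in Slim; last first.
  by rewrite pnatr_eq0 -lt0n !expn_gt0.
set pi := \prod_(p <- J) _ in piP Slim.
clearbody pi.
have [M0 M0P] := large_common_prime_bound R He.
have Hinv := @cvg_inv_double R.
(* With 1/(2H) below this value, the second tail term k(k+1)/(2H) is at most eps/4. *)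
have c0 : 0 < eps / 4 / (k * k.+1).+1%:R by rewrite divr_gt0 // ltr0n.
move/cvgrPdist_le/(_ _ c0): Hinv => Hinv.
move/cvgrPdist_le/(_ _ eps4): Slim => Slim.
have Hbig : \forall H \near \oo, (M0.+1 <= H)%N by exists M0.+1.
near=> H.
have MH : (M0.+1 <= H)%N by near: H.
have H0 : (0 < H)%N by apply: leq_trans MH.
have M2H : (M0 <= 2 * H)%N by apply: leq_trans (ltnW MH) (leq_pmull _ _).
have Spi : `|pi - #|boxset e (2 * H) H S|%:R / (2 * H%:R) ^+ (d.+3 * k)| <= eps / 4 by near: H.
have Hc : `|0 - (2 * H%:R)^-1 : R| <= eps / 4 / (k * k.+1).+1%:R by near: H.
have W0 : 0 < W H by rewrite ltr0n !expn_gt0 muln_gt0 H0.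
have tail := M0P d.+1 L H isT H0 M2H.
rewrite box_countE; rewrite WE in Spi *.
have SC : W H - #|boxset e (2 * H) H S|%:R = #|boxset e (2 * H) H (~` S)|%:R.
  rewrite /W -(card_boxset_all K) -(cardsC (boxset e (2 * H) H S)) -boxsetC natrD.
  by rewrite addrC addKr.
have lo : W H - #|boxset e (2 * H) H S|%:R <= #|boxset e (2 * H) H T|%:R.
  rewrite SC ler_nat; apply/subset_leq_card/fintype.subsetP => f /in_boxset nSf.
  apply/in_boxset; rewrite /T eisenstein_tuplesE; apply: contrapT => nT.
  apply: nSf => p _ Ep; apply: nT; exists (\val p) => //; exact: val_prime.
have up : #|boxset e (2 * H) H T|%:R <= W H - #|boxset e (2 * H) H S|%:R
    + #|boxset e (2 * H) H (large_common_prime d.+1 L)|%:R :> R.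
  rewrite SC -natrD ler_nat; apply: leq_trans (leq_card_setU _ _).
  apply/subset_leq_card/fintype.subsetP => f /in_boxset.
  rewrite /T eisenstein_tuplesE => -[p pp Ep]; apply/finset.setUP.
  pose q : set_type (nzPrimeIdeals K) := SigSub (mem_set pp).
  have [qJ|qJ] := boolP (q \in J).
    by left; apply/in_boxset => Sf; apply: (Sf q).
  (* A vanishing a_0 would lie in p^2. As the degree is at least 2, a_0 and a_1 both come before the
     leading coefficient and so lie in p. *)
  right; apply/in_boxset; have [lead low sq] := Ep; split.
    apply/eqP => f0; apply: sq; rewrite [vpt _ _ _ _ _]f0.
    exact: ideal_set0 (ideal_square_ideal (prime_ideal pp)).
  exists p; split=> //; [|exact: low|exact: low].
  move=> l lp pl; rewrite ltnNge; apply: contra qJ => lL.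
  by rewrite inE; apply/orP; right; rewrite inE; exact: (JLP q l lp pl lL).
move: tail; rewrite -/(W H) -ler_pdivrMr // => tail.
have {}Hc : (k * k.+1)%:R / (2 * H)%:R <= eps / 4.
  move: Hc; rewrite sub0r normrN ger0_norm ?invr_ge0 ?mulr_ge0 // ler_pdivlMr ?ltr0n //.
  rewrite [_ / (2 * H)%:R]mulrC [(2 * H)%:R]natrM; apply: le_trans.
  rewrite ler_wpM2l ?invr_ge0 ?mulr_ge0 //.
  by rewrite ler_nat.
move: lo up; rewrite -(ler_pM2r (_ : 0 < (W H)^-1)) ?invr_gt0 // mulrBl divff ?gt_eqF // => lo.
rewrite -(ler_pM2r (_ : 0 < (W H)^-1)) ?invr_gt0 // mulrDl mulrBl divff ?gt_eqF // => up.
move: Spi tail lo up piP LP Hc.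
move: (_ / W H) (_ / W H) (_ / W H) (_ / L%:R) (_ / (2 * H)%:R) => x1 x2 x3 x4 x5.
rewrite !ler_norml => /andP[? ?] ? ? ? /andP[? ?] ? ?; apply/andP; split; lra.
Unshelve. all: by end_near.
Qed.

End Conclusion.

Theorem corollary15 (R : realType) (K : fieldExtType rat) (d : nat)
    (hd : (2 <= d)%N) :
  exists P : R,
    has_prod
      (fun p : set_type (nzPrimeIdeals K) =>
         1 - ((idealNorm p)%:R - 1) ^+ 2 / (idealNorm p)%:R ^+ (d + 2)) P
    /\ has_density (@eisenstein_tuples K d) (1 - P).
Proof.
have [P [PP PJ Peps]] := has_prod_contraction (@eisenstein_density_contraction R K d).
(* P is fixed before any basis is introduced, which yields independence of the integral basis. *)
exists P; split; first exact: PP.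
by move=> e He; apply: (eisenstein_has_density He hd PJ Peps).
Qed.
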